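(* Fix a hypergeometric datum $(\alpha,\beta)$ with $0\notin\alpha$, and let $z\in\mathbb{Q}\setminus\{0,1\}$. Given the values $H_p(\alpha;\beta\,|\,z)$ for all primes $p\le X$ of good reduction, one can compute the first $X$ coefficients of the Dirichlet $L$-series associated to the hypergeometric motive $M^{\alpha,\beta}_z$ in at most $O(X^{3/2})$ arithmetic operations.
   Context: A hypergeometric datum is a pair of disjoint tuples $\alpha=(\alpha_1,\dots,\alpha_r)$, $\beta=(\beta_1,\dots,\beta_r)$ with entries in $\mathbb{Q}\cap[0,1)$, each Galois-stable: within each tuple, any two reduced fractions with the same denominator occur with the same multiplicity. A prime $p$ is of good reduction if $z$ and $z-1$ are both $p$-adic units and all $\alpha_j,\beta_j$ are $p$-integral. All other primes are bad; there are finitely many. Let $Z_{\alpha,\beta}(x)=\#\{j:\alpha_j\le x\}-\#\{j:\beta_j\le x\}$ for $x\in[0,1]$, let $w=\max_{x\in[0,1]}Z_{\alpha,\beta}(x)-\min_{x\in[0,1]}Z_{\alpha,\beta}(x)-1$, and let $D=\frac{w+1-\#\{j:\beta_j=0\}}{2}$. Let $\{x\}=x-\lfloor x\rfloor$. Let $\Gamma_p:\mathbb{Z}_p\to\mathbb{Z}_p^\times$ be Morita's $p$-adic gamma function, the unique continuous function with $\Gamma_p(n+1)=(-1)^{n+1}\prod_{1\le i\le n,\,(i,p)=1} i$ for all integers $n\ge 0$. For $q=p^f$ with $p$ good, set $$\Gamma_q^*(x)=\prod_{v=0}^{f-1}\Gamma_p(\{p^vx\}),\qquad (x)_m^*=\frac{\Gamma_q^*\left(x+\frac{m}{1-q}\right)}{\Gamma_q^*(x)},$$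 $$\eta_m(x_1,\dots,x_r)=\sum_{j=1}^r\sum_{v=0}^{f-1}\left(\left\{p^v\left(x_j+\tfrac{m}{1-q}\right)\right\}-\{p^vx_j\}\right),$$ $$\xi_m(\beta)=\#\{j:\beta_j=0\}-\#\left\{j:\beta_j+\tfrac{m}{1-q}=0\right\}.$$ Let $[z]\in\mathbb{Z}_p$ be the unique $(p-1)$-st root of unity congruent to $z$ modulo $p$. Then $$H_q(\alpha;\beta\,|\,z)=\frac{1}{1-q}\sum_{m=0}^{q-2}(-p)^{\eta_m(\alpha)-\eta_m(\beta)}\,q^{D+\xi_m(\beta)}\left(\prod_{j=1}^r\frac{(\alpha_j)_m^*}{(\beta_j)_m^*}\right)[z]^m .$$ The $L$-series associated to $M^{\alpha,\beta}_z$ is the Dirichlet series $\sum_{n\ge1}a_nn^{-s}=\prod_pL_p(p^{-s})^{-1}$ where, for each good prime $p$, $L_p(T)=\det(1-T\,\mathrm{Frob}\mid M^{\alpha,\beta}_z)=\exp\left(-\sum_{f\ge1}H_{p^f}(\alpha;\beta\,|\,z)\frac{T^f}{f}\right)$ (a polynomial of degree $r$ with integer coefficients), by the known trace formula $H_{p^f}(\alpha;\beta\,|\,z)=\mathrm{Tr}(\mathrm{Frob}^f\mid M^{\alpha,\beta}_z)\in\mathbb{Z}$. Convention: the finitely many Euler factors at bad primes are handled separately and are regarded as given. Arithmetic operations are ring operations on numbers, including operations in $\mathbb{Z}_p$ carried out to the $p$-adic working precision needed to determine the integers $H_q$. Evaluating $\Gamma_p$ modulo $p^f$ at one argument takes $O(pf)$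 such operations, and evaluating $H_{p^f}(\alpha;\beta\,|\,z)$ from its defining formula takes $O(fp^f)$ of them (with $(\alpha,\beta)$ fixed). *)

(* Defs.v *)
From HB Require Import structures.
From mathcomp Require Import all_boot all_order all_algebra all_field.
From mathcomp Require Import boolp classical_sets reals exp.

Set Implicit Arguments.
Unset Strict Implicit.
Unset Printing Implicit Defensive.

Import Order.TTheory GRing.Theory Num.Theory.
Local Open Scope ring_scope.

(* As for 'F_p, the base is forced to be a prime, so that the structures below
   need no hypothesis on p; padic_baseE shows that it is p when p is prime. *)
Definition padic_base (p : nat) : nat := (Zp_trunc (pdiv p)).+2.

Lemma padic_baseE (p : nat) : prime p -> padic_base p = p.
Proof. by move=> p_pr; rewrite /padic_base pdiv_id // Zp_cast ?prime_gt1. Qed.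

Lemma padic_base_prime (p : nat) : prime (padic_base p).
Proof.
rewrite /padic_base; case: (leqP p 1) => [|p_gt1]; last first.
  by rewrite Zp_cast ?prime_gt1 ?pdiv_prime.
by case: p => [|[|p]].
Qed.

Lemma padic_pow_gt0 (p n : nat) : (0 < padic_base p ^ n)%N.
Proof. by rewrite expn_gt0 prime_gt0 ?padic_base_prime. Qed.

Lemma padic_pow_dvd (p n : nat) : (padic_base p ^ n %| padic_base p ^ n.+1)%N.
Proof. by rewrite expnS dvdn_mull. Qed.

(* Elements of the inverse limit of the Z/p^n; padic_res x n is the
   representative in [0, p^n) of the class of x modulo p^n. *)
Record padic (p : nat) := Padic {
  padic_res :> nat -> nat;
  _ : forall n, (padic_res n.+1 %% padic_base p ^ n)%N = padic_res n
}.

HB.instance Definition _ (p : nat) := gen_eqMixin (padic p).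
HB.instance Definition _ (p : nat) := gen_choiceMixin (padic p).

Section PadicRing.
Variable p : nat.
Local Notation b := (padic_base p).
Implicit Types x y t : padic p.

Lemma padicP x y : (forall n, x n = y n) -> x = y.
Proof.
case: x y => [x hx] [y hy] /= e.
have exy : x = y by apply/funext.
by case: y / exy hy e => hy _; congr Padic; exact: Prop_irrelevance.
Qed.

Lemma padic_succ x n : (x n.+1 %% b ^ n)%N = x n.
Proof. by case: x. Qed.

Lemma padic_mod x n : (x n %% b ^ n)%N = x n.
Proof. by rewrite -padic_succ modn_mod. Qed.

Fact padic_of_nat_subproof (k : nat) n :
  ((k %% b ^ n.+1) %% b ^ n)%N = (k %% b ^ n)%N.
Proof. by rewrite modn_dvdm // padic_pow_dvd. Qed.
Definition padic_of_nat k := Padic (padic_of_nat_subproof k).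

Fact padic_add_subproof x y n :
  (((x n.+1 + y n.+1) %% b ^ n.+1) %% b ^ n)%N = ((x n + y n) %% b ^ n)%N.
Proof.
by rewrite modn_dvdm ?padic_pow_dvd // -modnDm !padic_succ.
Qed.
Definition padic_add x y := Padic (padic_add_subproof x y).

Fact padic_opp_subproof x n :
  (((b ^ n.+1 - x n.+1) %% b ^ n.+1) %% b ^ n)%N = ((b ^ n - x n) %% b ^ n)%N.
Proof.
rewrite modn_dvdm ?padic_pow_dvd //; apply/eqP; rewrite -(eqn_modDr (x n.+1)).
have lt_x m : (x m <= b ^ m)%N.
  by rewrite ltnW // -(padic_mod x m) ltn_mod padic_pow_gt0.
rewrite subnK // -(modnDmr _ (x n.+1)) padic_succ subnK //.
by rewrite (eqP (padic_pow_dvd p n)) modnn.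
Qed.
Definition padic_opp x := Padic (padic_opp_subproof x).

Fact padic_mul_subproof x y n :
  (((x n.+1 * y n.+1) %% b ^ n.+1) %% b ^ n)%N = ((x n * y n) %% b ^ n)%N.
Proof.
by rewrite modn_dvdm ?padic_pow_dvd // -modnMm !padic_succ.
Qed.
Definition padic_mul x y := Padic (padic_mul_subproof x y).

Fact padic_addA : associative padic_add.
Proof. by move=> x y t; apply: padicP => n /=; rewrite modnDml modnDmr addnA. Qed.
Fact padic_addC : commutative padic_add.
Proof. by move=> x y; apply: padicP => n /=; rewrite addnC. Qed.
Fact padic_add0 : left_id (padic_of_nat 0) padic_add.
Proof. by move=> x; apply: padicP => n /=; rewrite mod0n padic_mod. Qed.
Fact padic_addN : left_inverse (padic_of_nat 0) padic_opp padic_add.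
Proof.
move=> x; apply: padicP => n /=; rewrite modnDml subnK ?modnn ?mod0n //.
by rewrite ltnW // -(padic_mod x n) ltn_mod padic_pow_gt0.
Qed.

HB.instance Definition _ := GRing.isZmodule.Build (padic p)
  padic_addA padic_addC padic_add0 padic_addN.

Fact padic_mulA : associative padic_mul.
Proof. by move=> x y t; apply: padicP => n /=; rewrite modnMml modnMmr mulnA. Qed.
Fact padic_mulC : commutative padic_mul.
Proof. by move=> x y; apply: padicP => n /=; rewrite mulnC. Qed.
Fact padic_mul1 : left_id (padic_of_nat 1) padic_mul.
Proof. by move=> x; apply: padicP => n /=; rewrite modnMml mul1n padic_mod. Qed.
Fact padic_mulDl : left_distributive padic_mul padic_add.
Proof.
move=> x y t; apply: padicP => n /=.
by rewrite modnMml modnDm mulnDl.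
Qed.
Fact padic_1neq0 : padic_of_nat 1 != 0 :> padic p.
Proof.
apply/eqP => /(congr1 (fun x : padic p => x 1%N)) /=.
by rewrite expn1 mod0n modn_small ?prime_gt1 ?padic_base_prime.
Qed.

HB.instance Definition _ := GRing.Zmodule_isComNzRing.Build (padic p)
  padic_mulA padic_mulC padic_mul1 padic_mulDl padic_1neq0.

Definition padic_unit : pred (padic p) := fun x => `[< exists y, y * x = 1 >].
Definition padic_inv x : padic p :=
  if pselect (exists y, y * x = 1) is left e then projT1 (cid e) else x.

Fact padic_mulVx : {in padic_unit, left_inverse 1 padic_inv *%R}.
Proof.
move=> x /asboolP ux; rewrite /padic_inv; case: pselect => // e.
exact: projT2 (cid e).
Qed.
Fact padic_unitPl x y : y * x = 1 -> padic_unit x.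
Proof. by move=> yx; apply/asboolP; exists y. Qed.
Fact padic_inv_out : {in [predC padic_unit], padic_inv =1 id}.
Proof.
by move=> x /asboolP nux; rewrite /padic_inv; case: pselect.
Qed.

HB.instance Definition _ := GRing.ComNzRing_hasMulInverse.Build (padic p)
  padic_mulVx padic_unitPl padic_inv_out.

Lemma padic_mod_le x m n : (m <= n)%N -> (x n %% b ^ m)%N = x m.
Proof.
elim: n => [|n IHn]; first by rewrite leqn0 => /eqP ->; rewrite padic_mod.
rewrite leq_eqVlt ltnS => /predU1P[->|le_mn]; first exact: padic_mod.
by rewrite -(modn_dvdm _ (dvdn_exp2l b le_mn)) padic_succ IHn.
Qed.

Fact padic_idomain : GRing.integral_domain_axiom (padic p).
Proof.
move=> x y xy0; apply/negPn/negP; rewrite negb_or.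
have nz t : t != 0 -> exists2 n, t n != 0 & True.
  move=> /eqP nz_t; apply: contrapT => no_n; apply: nz_t; apply: padicP => n.
  by rewrite [RHS]mod0n; apply: contrapT => /eqP ?; apply: no_n; exists n.
case/andP => /nz[m xm _] /nz[n yn _].
have b_pr := padic_base_prime p.
have ndvd t k l : t k != 0 -> (k <= l)%N -> ~~ (b ^ k %| t l)%N.
  by move=> tk le_kl; rewrite /dvdn padic_mod_le.
have := ndvd x m _ xm (leq_addr n m); have := ndvd y n _ yn (leq_addl m n).
have pos t k l : t k != 0 -> (k <= l)%N -> (0 < t l)%N.
  by move=> tk /(ndvd _ _ _ tk); case: (t l); rewrite ?dvdn0.
have := pos x m _ xm (leq_addr n m); have := pos y n _ yn (leq_addl m n).
move=> ygt0 xgt0.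
rewrite !pfactor_dvdn // -!ltnNge => ltn ltm.
have := congr1 (fun t : padic p => t (m + n)%N) xy0.
rewrite [RHS]mod0n => /eqP; rewrite -[_ == _]/(b ^ (m + n) %| _ * _)%N.
rewrite pfactor_dvdn ?muln_gt0 ?xgt0 // lognM // leqNgt => /negP; apply.
by rewrite (leq_trans _ (leq_add (ltnW ltm) ltn)) // addnS ltnS ?leqnn // -addnS.
Qed.

HB.instance Definition _ :=
  GRing.ComUnitRing_isIntegral.Build (padic p) padic_idomain.

End PadicRing.

Definition padic_cong (p n : nat) (x y : padic p) : Prop := x n = y n.

Definition padic_continuous (p : nat) (g : padic p -> padic p) : Prop :=
  forall x n, exists m, forall y, padic_cong m x y -> padic_cong n (g x) (g y).

(* Definite descriptions: the object characterized is unique by classical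
   results (for padic_teichmuller, when p is an odd prime and x is a unit). *)
Definition is_morita_gamma (p : nat) (g : padic p -> padic p) : Prop :=
  [/\ padic_continuous g,
      forall x, g x \is a GRing.unit
    & forall n : nat, g n.+1%:R =
        (-1) ^+ n.+1 * \prod_(1 <= i < n.+1 | coprime i p) i%:R].

Definition padic_gamma (p : nat) : padic p -> padic p :=
  xget (fun=> 1) [set g | is_morita_gamma g]%classic.

Definition padic_teichmuller (p : nat) (x : padic p) : padic p :=
  xget 0 [set t | t ^+ p.-1 = 1 /\ padic_cong 1 t x]%classic.

Definition galois_stable (s : seq rat) : Prop :=
  forall x y : rat, 0 <= x < 1 -> 0 <= y < 1 -> denq x = denq y ->
  count_mem x s = count_mem y s.

Definition hypergeometric_datum (r : nat) (alpha beta : r.-tuple rat) : Prop :=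
  [/\ all (fun x => 0 <= x < 1) alpha, all (fun x => 0 <= x < 1) beta,
      ~~ has [in alpha] beta, galois_stable alpha & galois_stable beta].

Definition padic_integral (p : nat) (x : rat) : bool := ~~ (p %| `|denq x|)%N.
Definition padic_unitq (p : nat) (x : rat) : bool :=
  padic_integral p x && ~~ (p %| `|numq x|)%N.

Definition good_prime (alpha beta : seq rat) (z : rat) (p : nat) : bool :=
  [&& prime p, padic_unitq p z, padic_unitq p (z - 1),
      all (padic_integral p) alpha & all (padic_integral p) beta].

Definition frac_part (x : rat) : rat := x - (Num.floor x)%:~R.

Section HypergeometricSum.
Variables alpha beta : seq rat.

Definition zigzag (x : rat) : int :=
  (count (fun a => a <= x) alpha)%:Z - (count (fun b => b <= x) beta)%:Z.

Definition zigzag_values : set int :=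
  [set zigzag x | x in [set x : rat | 0 <= x <= 1]]%classic.
Definition zigzag_max : int :=
  xget 0 [set k | zigzag_values k /\ forall l, zigzag_values l -> l <= k]%classic.
Definition zigzag_min : int :=
  xget 0 [set k | zigzag_values k /\ forall l, zigzag_values l -> k <= l]%classic.

Definition hyper_weight : int := zigzag_max - zigzag_min - 1.

(* The division is exact for a hypergeometric datum with 0 \notin alpha: the
   values of zigzag are then symmetric about - #{j : beta_j = 0} / 2. *)
Definition hyper_D : int :=
  ((hyper_weight + 1 - (count_mem (0 : rat) beta)%:Z) %/ 2)%Z.

Variables (z : rat) (p f : nat).
Let q : nat := (p ^ f)%N.

Definition hyper_shift (m : nat) (x : rat) : rat := x + m%:R / (1 - q%:R).

Definition hyper_gammaq (x : rat) : padic p :=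
  \prod_(v < f) padic_gamma (ratr (frac_part (p%:R ^+ v * x))).

Definition hyper_poch (m : nat) (x : rat) : padic p :=
  hyper_gammaq (hyper_shift m x) / hyper_gammaq x.

Definition hyper_eta (m : nat) (xs : seq rat) : rat :=
  \sum_(x <- xs) \sum_(v < f)
    (frac_part (p%:R ^+ v * hyper_shift m x) - frac_part (p%:R ^+ v * x)).

Definition hyper_xi (m : nat) : int :=
  (count_mem (0 : rat) beta)%:Z - (count (fun b => hyper_shift m b == 0) beta)%:Z.

(* For a hypergeometric datum, hyper_eta m alpha - hyper_eta m beta is an
   integer, which Num.floor only casts to int. *)
Definition hyper_sum : {fraction padic p} :=
  (1 - q%:R)^-1 *
  \sum_(m < q.-1)
    (- p%:R) ^ (Num.floor (hyper_eta m alpha - hyper_eta m beta)) *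
    q%:R ^ (hyper_D + hyper_xi m) *
    tofrac ((\prod_(a <- alpha) hyper_poch m a) /
            (\prod_(b <- beta) hyper_poch m b)) *
    tofrac (padic_teichmuller (ratr z)) ^+ m.

End HypergeometricSum.

(* exp (\sum_(i >= 0) g i T^i), for g 0 = 0. *)
Definition fps_exp (g : nat -> rat) (n : nat) : rat :=
  (\sum_(k < n.+1) (k`!%:R)^-1 *: (\poly_(i < n.+1) g i) ^+ k)`_n.

(* The inverse of \sum_(i >= 0) u i T^i, for u 0 = 1, as a geometric series. *)
Definition fps_inv (u : nat -> rat) (n : nat) : rat :=
  (\sum_(k < n.+1) (1 - \poly_(i < n.+1) u i) ^+ k)`_n.

(* u : nat -> rat stands for \sum_(n >= 1) u n n^{-s}. *)
Definition dirichlet_one (n : nat) : rat := (n == 1%N)%:R.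
Definition dirichlet_mul (u v : nat -> rat) (n : nat) : rat :=
  \sum_(d <- divisors n) u d * v (n %/ d)%N.

(* \sum_(k >= 0) u k T^k at T = p^{-s}. *)
Definition dirichlet_local (p : nat) (u : nat -> rat) (n : nat) : rat :=
  if n == (p ^ logn p n)%N then u (logn p n) else 0.

(* The factors at the primes p > n do not contribute to the n-th coefficient. *)
Definition euler_product (u : nat -> nat -> rat) (n : nat) : rat :=
  (\big[dirichlet_mul/dirichlet_one]_(p < n.+1 | prime p)
      dirichlet_local p (u p)) n.

(* H p f is the value of hyper_sum for q = p^f; badL p is the Euler factor at
   the bad prime p. *)
Definition hyper_euler_factor (alpha beta : seq rat) (z : rat)
    (H : nat -> nat -> int) (badL : nat -> {poly int}) (p n : nat) : rat :=
  if good_prime alpha beta z p then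
    fps_exp (fun f => if f == 0%N then 0 else - ((H p f)%:~R / f%:R)) n
  else ((badL p)`_n)%:~R.

Definition hyper_lcoef (alpha beta : seq rat) (z : rat)
    (H : nat -> nat -> int) (badL : nat -> {poly int}) : nat -> rat :=
  euler_product
    (fun p => fps_inv (hyper_euler_factor alpha beta z H badL p)).

(* Frobenius at p on an r-dimensional realization of the motive. *)
Definition trace_formula (r : nat) (h : nat -> int) : Prop :=
  exists F : 'M[algC]_r,
    (forall f, (0 < f)%N -> (h f)%:~R = \tr (F ^+ f)) /\
    (exists2 L : {poly int}, size L = r.+1 &
       map_poly intr L = \det (1%:M - 'X *: map_mx polyC F)).

(* A random access machine over the integers with unit cost operations. The
   division with remainder provides arithmetic in Z/p^N, that is, operations in
   Z_p at finite precision. Every evaluated node of an expression and every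
   executed command is charged one step, so that the number of steps bounds the
   number of arithmetic operations. *)

Inductive binop := OpAdd | OpSub | OpMul | OpQuo | OpRem | OpLe | OpEq.

Definition binop_eval (o : binop) (a b : int) : int :=
  match o with
  | OpAdd => a + b
  | OpSub => a - b
  | OpMul => a * b
  | OpQuo => (a %/ b)%Z
  | OpRem => (a %% b)%Z
  | OpLe => (a <= b)%R : nat
  | OpEq => (a == b) : nat
  end.

(* The memory consists of arrays, numbered by nat and indexed by int. *)
Definition memory := nat -> int -> int.

Definition mem_upd (m : memory) (a : nat) (i v : int) : memory :=
  fun a' i' => if (a' == a) && (i' == i) then v else m a' i'.

Inductive expr :=
| Cst of int
| Read of nat & expr
| Bin of binop & expr & expr.

Fixpoint expr_eval (m : memory) (e : expr) : int :=
  match e with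
  | Cst c => c
  | Read a i => m a (expr_eval m i)
  | Bin o e1 e2 => binop_eval o (expr_eval m e1) (expr_eval m e2)
  end.

Fixpoint expr_cost (e : expr) : nat :=
  match e with
  | Cst _ => 1
  | Read _ i => (expr_cost i).+1
  | Bin _ e1 e2 => (expr_cost e1 + expr_cost e2).+1
  end.

(* Call c es a i runs c in a fresh memory (see mem_init) with the values of es as arguments,
   and stores its (scalar) result in cell i of array a. *)
Inductive cmd :=
| Skip
| Write of nat & expr & expr
| Seq of cmd & cmd
| If of expr & cmd & cmd
| While of expr & cmd
| Call of cmd & seq expr & nat & expr.

(* Calling convention: arguments in array 0, input table in array 1, results in
   array 2; all the other cells are initially 0. *)
Definition mem_init (args : seq int) (table : nat -> int) : memory :=
  fun a i => match a, i with
             | 0%N, Posz k => nth 0 args k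
             | 1%N, Posz k => table k
             | _, _ => 0
             end.

Definition mem_out (m : memory) (k : nat) : int := m 2%N k%:Z.

(* exec c m t m': run from the memory m, the command c halts after t steps in
   the memory m'. *)
Inductive exec : cmd -> memory -> nat -> memory -> Prop :=
| ExecSkip m : exec Skip m 1 m
| ExecWrite m a i e :
    exec (Write a i e) m (expr_cost i + expr_cost e).+1
      (mem_upd m a (expr_eval m i) (expr_eval m e))
| ExecSeq c1 c2 m m1 m2 t1 t2 :
    exec c1 m t1 m1 -> exec c2 m1 t2 m2 ->
    exec (Seq c1 c2) m (t1 + t2).+1 m2
| ExecIf e c1 c2 m m1 t :
    exec (if expr_eval m e != 0 then c1 else c2) m t m1 ->
    exec (If e c1 c2) m (expr_cost e + t).+1 m1
| ExecWhileStop e c m :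
    expr_eval m e = 0 -> exec (While e c) m (expr_cost e).+1 m
| ExecWhileStep e c m m1 m2 t1 t2 :
    expr_eval m e != 0 -> exec c m t1 m1 -> exec (While e c) m1 t2 m2 ->
    exec (While e c) m (expr_cost e + t1 + t2).+1 m2
| ExecCall c es a i m m1 t :
    exec c (mem_init [seq expr_eval m e | e <- es] (fun=> 0)) t m1 ->
    exec (Call c es a i) m
      (sumn [seq expr_cost e | e <- es] + expr_cost i + t).+1
      (mem_upd m a (expr_eval m i) (mem_out m1 0)).

Definition evaluation_cost (good : pred nat) (H : nat -> nat -> int) : Prop :=
  exists (E : cmd) (C : nat), forall p f, good p -> (0 < f)%N ->
  exists t m, [/\ exec E (mem_init [:: p%:Z; f%:Z] (fun=> 0)) t m,
                  mem_out m 0 = H p f & (t <= C * (f * p ^ f))%N].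

(* Main.v *)
Require Import Defs.
From HB Require Import structures.
From mathcomp Require Import all_boot all_order all_algebra all_field.
From mathcomp Require Import boolp classical_sets reals exp.
From mathcomp Require Import ring zify.

(** Why the theorem holds.

    Write the L-series as the sum of a_n n^{-s}, with a the product over the
    primes of the inverse local factors 1 / L_p(p^{-s}).  Its coefficients are
    multiplicative, so a_n = a_q a_{n/q} for q the full power in n of a prime
    p (euler_product_split), and only the values at prime powers need work.
    Writing l_{p,k} for the coefficients of L_p, two recurrences give them:
      k l_{p,k} = - sum_{1 <= i <= k} H_{p^i} l_{p,k-i}   (p good),
      a_{p^k} = - sum_{1 <= i <= k} l_{p,i} a_{p^{k-i}}.
    The first is Newton's identity: the trace formula makes H_{p^i} the i-th
    power sum of the eigenvalues of Frobenius, and det (1 - T F) the product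
    of the 1 - x T over these eigenvalues.  It determines the exponential
    series that defines L_p, which is therefore an integral polynomial
    (fps_exp_trace); this is why a machine over the integers can run it, the
    division by k being exact.

    The program treats n = 2, ..., X in turn.  Trial division up to sqrt n
    finds the smallest prime factor p of n.  If n is not a power of p, then
    a_n is a product of two known coefficients.  If n = p^k, then H_{p^k} is
    read from the input when k = 1 and otherwise evaluated from its defining
    formula, in O(k p^k) steps, and the two recurrences give a_n.  Local
    factors at the finitely many bad primes are constants of the program
    (bad_primes_finite).

    Trial division costs O(X sqrt X) in all.  The evaluations cost the sum of
    k p^k over k >= 2 and p^k <= X (sum_prime_power_cost_leq).  There are at
    most sqrt X values of p for each of k = 2, 3, which thus contribute
    O(X^{3/2}); when k >= 4 one has p <= X^{1/4} and k <= log_2 X, which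
    contributes at most O(X X^{1/4} (log X)^2), and (log X)^2 = O(X^{1/4}). *)

Set Implicit Arguments.
Unset Strict Implicit.
Unset Printing Implicit Defensive.

Import Order.TTheory GRing.Theory Num.Theory.
Local Open Scope ring_scope.

(** * Recurrences for exponentials and inverses of power series *)

Lemma coef_mul_truncl (A : nzRingType) (g : nat -> A) (P : {poly A}) N m :
  (m <= N)%N ->
  ((\poly_(i < N.+1) g i) * P)`_m = \sum_(i < m.+1) g i * P`_(m - i).
Proof.
move=> mN; rewrite coefM; apply: eq_bigr => i _.
by rewrite coef_poly ltnS (leq_trans _ mN) // -ltnS ltn_ord.
Qed.

Lemma coefXn_mul_small (A : nzRingType) (Q : {poly A}) k m :
  (m < k)%N -> ('X^k * Q)`_m = 0.
Proof. by move=> mk; rewrite coefXnM mk. Qed.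

Lemma coef0_exp_small (A : comNzRingType) (P : {poly A}) k m :
  P`_0 = 0 -> (m < k)%N -> (P ^+ k)`_m = 0.
Proof.
move=> P0 mk.
have -> : P = 'X * \poly_(i < size P) P`_i.+1.
  apply/polyP => -[|i]; rewrite coefXM //= coef_poly.
  by case: ltnP => // /leq_trans le; rewrite nth_default // le.
by rewrite exprMn coefXn_mul_small.
Qed.

Lemma inverse_recurrence_unique (A : nzRingType) (u v w : nat -> A) n :
  u 0%N = 1 -> v 0%N = 1 -> w 0%N = 1 ->
  (forall m, (0 < m <= n)%N -> \sum_(i < m.+1) u i * v (m - i)%N = 0) ->
  (forall m, (0 < m <= n)%N -> \sum_(i < m.+1) u i * w (m - i)%N = 0) ->
  forall m, (m <= n)%N -> v m = w m.
Proof.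
move=> u0 v0 w0 hv hw; elim/ltn_ind => -[|m] IH mn; first by rewrite v0 w0.
have hs (t : nat -> A) : \sum_(i < m.+2) u i * t (m.+1 - i)%N =
    t m.+1 + \sum_(i < m.+1) u i.+1 * t (m - i)%N.
  by rewrite big_ord_recl u0 mul1r subn0; congr (_ + _); apply: eq_bigr.
have := hv m.+1 mn; rewrite -[RHS](hw m.+1 mn) !hs.
suff -> : \sum_(i < m.+1) u i.+1 * v (m - i)%N =
          \sum_(i < m.+1) u i.+1 * w (m - i)%N by move/addIr.
apply: eq_bigr => i _; congr (_ * _); apply: IH; first by rewrite ltnS leq_subr.
by rewrite (leq_trans (leq_subr _ _)) // ltnW.
Qed.

(** The geometric series defining the inverse is cut off at a degree depending
    on the coefficient that is read.  Any cut-off N inverts U up to degree N,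
    since U times the sum of the (1 - U)^k telescopes to 1 - (1 - U)^(N+1). *)
Lemma fps_inv_trunc (u : nat -> rat) N m : u 0%N = 1 -> (m <= N)%N ->
  \sum_(i < m.+1) u i *
     (\sum_(k < N.+1) (1 - \poly_(i < N.+1) u i) ^+ k)`_(m - i) = (m == 0%N)%:R.
Proof.
move=> u0 mN; rewrite -(coef_mul_truncl _ _ mN); set U := \poly_(i < _) _.
have -> : U * \sum_(k < N.+1) (1 - U) ^+ k = 1 - (1 - U) ^+ N.+1.
  by rewrite -[RHS]opprB subrX1 -mulNr !opprB addrCA subrr addr0.
rewrite coefB coef1 coef0_exp_small ?subr0 //.
by rewrite coefB coef1 coef_poly u0 subrr.
Qed.

Lemma fps_inv0 (u : nat -> rat) : fps_inv u 0 = 1.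
Proof. by rewrite /fps_inv big_ord1 expr0 coef1. Qed.

(** All cut-offs beyond m give the same m-th coefficient, both being determined
    by the convolution identity; so the identity for one cut-off passes to
    fps_inv. *)
Lemma fps_invS (u : nat -> rat) n : u 0%N = 1 ->
  fps_inv u n.+1 = - \sum_(i < n.+1) u i.+1 * fps_inv u (n - i).
Proof.
move=> u0.
pose V N m := (\sum_(k < N.+1) (1 - \poly_(i < N.+1) u i) ^+ k)`_m.
have V0 N : V N 0%N = 1.
  have := @fps_inv_trunc u N 0 u0 isT.
  by rewrite big_ord1 u0 mul1r.
have VE N m : (m <= N)%N -> V N m = fps_inv u m.
  move=> mN; apply: (@inverse_recurrence_unique _ u _ (V m) m) => // k.
    by case: k => [//|k] km; rewrite fps_inv_trunc // (leq_trans _ mN).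
  by case: k => [//|k] km; rewrite fps_inv_trunc.
have := @fps_inv_trunc u n.+1 n.+1 u0 (leqnn _).
rewrite big_ord_recl u0 mul1r subn0 => /eqP; rewrite addr_eq0 => /eqP.
rewrite -/(V n.+1 n.+1) VE // => ->; congr (- _); apply: eq_bigr => i _.
rewrite lift0 subSS -/(V n.+1 (n - i)%N) VE //.
by rewrite (leq_trans (leq_subr _ _)).
Qed.

Lemma log_recurrence_unique (g v w : nat -> rat) n :
  v 0%N = 1 -> w 0%N = 1 ->
  (forall m, (m < n)%N -> m.+1%:R * v m.+1 = \sum_(i < m.+1) g i * v (m - i)%N) ->
  (forall m, (m < n)%N -> m.+1%:R * w m.+1 = \sum_(i < m.+1) g i * w (m - i)%N) ->
  forall m, (m <= n)%N -> v m = w m.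
Proof.
move=> v0 w0 hv hw; elim/ltn_ind => -[|m] IH mn; first by rewrite v0 w0.
apply: (@mulfI _ m.+1%:R); first by rewrite pnatr_eq0.
rewrite hv // hw //; apply: eq_bigr => i _; congr (_ * _); apply: IH.
  by rewrite ltnS leq_subr.
by rewrite (leq_trans (leq_subr _ _)) // ltnW.
Qed.

(** The logarithmic derivative: E' = P' E up to the top term P^N / N! of the
    truncated exponential, which has valuation at least N. *)
Lemma fps_exp_trunc (g : nat -> rat) N m : g 0%N = 0 -> (m < N)%N ->
  let E := \sum_(k < N.+1) (k`!%:R)^-1 *: (\poly_(i < N.+1) g i) ^+ k in
  m.+1%:R * E`_m.+1 = \sum_(i < m.+1) (i.+1%:R * g i.+1) * E`_(m - i).
Proof.
move=> g0 mN E; set P := \poly_(i < _) _ in E *.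
have P0 : P`_0 = 0 by rewrite coef_poly.
have dE : E^`() = P^`() * (E - (N`!%:R)^-1 *: P ^+ N).
  rewrite /E [in RHS]big_ord_recr /= addrK big_ord_recl derivD.
  rewrite expr0 fact0 invr1 scale1r derivC add0r (raddf_sum (@deriv rat)) mulr_sumr.
  apply: eq_bigr => i _; rewrite lift0 [LHS]derivZ deriv_exp /= -scaler_nat scalerA.
  rewrite -[in RHS]scalerAr; congr (_ *: _); rewrite factS natrM invfM mulrAC mulVf ?mul1r //.
  by rewrite pnatr_eq0.
rewrite mulr_natl -coef_deriv dE.
have PPN : (P^`() * P ^+ N)`_m = 0.
  rewrite coefM big1 // => i _.
  by rewrite (@coef0_exp_small _ P) ?mulr0 // (leq_ltn_trans (leq_subr _ _)).
have -> : (P^`() * (E - N`!%:R^-1 *: P ^+ N))`_m = (P^`() * E)`_m.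
  by rewrite mulrBr coefB -scalerAr coefZ PPN mulr0 subr0.
rewrite coefM; apply: eq_bigr => i _; congr (_ * _).
by rewrite coef_deriv coef_poly ltnS (leq_trans (ltn_ord i) mN) mulr_natl.
Qed.

Lemma fps_exp0 (g : nat -> rat) : fps_exp g 0 = 1.
Proof. by rewrite /fps_exp big_ord1 expr0 fact0 invr1 scale1r coef1. Qed.

Lemma fps_expS (g : nat -> rat) n : g 0%N = 0 ->
  n.+1%:R * fps_exp g n.+1 = \sum_(i < n.+1) i.+1%:R * g i.+1 * fps_exp g (n - i).
Proof.
move=> g0.
pose V N m := (\sum_(k < N.+1) (k`!%:R)^-1 *: (\poly_(i < N.+1) g i) ^+ k)`_m.
have V0 N : V N 0%N = 1.
  rewrite /V big_ord_recl expr0 fact0 invr1 scale1r coefD coef1 coef_sum.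
  rewrite big1 ?addr0 // => i _; rewrite coefZ lift0 coef0_exp_small ?mulr0 //.
  by rewrite coef_poly.
have VE N m : (m <= N)%N -> V N m = fps_exp g m.
  move=> mN; apply: (@log_recurrence_unique (fun i => i.+1%:R * g i.+1) _ (V m) m) => // k km;
    by rewrite fps_exp_trunc // (leq_trans _ mN).
rewrite -[fps_exp g n.+1]/(V n.+1 n.+1) fps_exp_trunc //; apply: eq_bigr => i _.
by congr (_ * _); apply: VE; rewrite (leq_trans (leq_subr _ _)).
Qed.

(** With S the power-sum series cut off at degree n + 1, the polynomial
    X D' + S D vanishes to order n + 2.  This is preserved by one more factor
    1 - x X, because (1 - x X) times the sum of the (x X)^j for 1 <= j <= n + 1
    telescopes to x X - (x X)^(n+2). *)
Lemma newton_identity (A : comNzRingType) (s : seq A) n :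
  let D := \prod_(x <- s) (1 - x *: 'X) in
  n.+1%:R * D`_n.+1 = - \sum_(i < n.+1) (\sum_(x <- s) x ^+ i.+1) * D`_(n - i).
Proof.
pose L x : {poly A} := \poly_(i < n.+2) (if i == 0%N then 0 else x ^+ i).
suff [Q DQ] : exists Q : {poly A}, 'X * (\prod_(x <- s) (1 - x *: 'X))^`() +
     (\sum_(x <- s) L x) * \prod_(x <- s) (1 - x *: 'X) = 'X^(n.+2) * Q.
  move=> D; have := congr1 (fun Q : {poly A} => Q`_n.+1) DQ.
  have -> : \sum_(x <- s) L x =
      \poly_(i < n.+2) (if i == 0%N then 0 else \sum_(x <- s) x ^+ i).
    apply/polyP => i; rewrite coef_sum coef_poly.
    case: ltnP => hi; last by rewrite big1 // => x _; rewrite coef_poly ltnNge hi.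
    case: i hi => [|i] hi; first by rewrite big1 // => x _; rewrite coef_poly.
    by apply: eq_bigr => x _; rewrite coef_poly hi.
  rewrite /= coefXn_mul_small // coefD coefXM /= coef_deriv -/D mulr_natl.
  rewrite coef_mul_truncl // big_ord_recl mul0r add0r => /eqP.
  by rewrite addr_eq0 => /eqP ->.
have LE x : L x * (1 - x *: 'X) = x *: 'X - (x *: 'X) ^+ n.+2.
  have -> : L x = x *: 'X * \sum_(i < n.+1) (x *: 'X) ^+ i.
    rewrite /L poly_def big_ord_recl scale0r add0r mulr_sumr.
    by apply: eq_bigr => i _; rewrite lift0 -exprS exprZn.
  have := subrX1 (x *: 'X : {poly A}) n.+1.
  rewrite -mulrA [_ * (1 - _)]mulrC -[1 - _]opprB mulNr => <-.
  by rewrite opprB mulrBr mulr1 -exprS.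
elim: s => [|x s [Q IH]].
  by exists 0; rewrite !big_nil derivC !mulr0 add0r mul0r.
exists ((1 - x *: 'X) * Q - x ^+ n.+2 *: \prod_(x <- s) (1 - x *: 'X)).
rewrite !big_cons; set D := \prod_(_ <- _) _ in IH *.
rewrite derivM derivB derivC derivZ derivX sub0r [RHS]mulrBr [in RHS]mulrCA -IH.
rewrite (_ : 'X^(n.+2) * _ = (x *: 'X - L x * (1 - x *: 'X)) * D).
  by rewrite -!mul_polyC; ring.
by rewrite LE opprB addrCA subrr addr0 exprZn -scalerAl -scalerAr.
Qed.

(** * Frobenius eigenvalues and the coefficients of a local factor *)

Lemma trig_mxM (A : pzRingType) n (M N : 'M[A]_n) :
  is_trig_mx M -> is_trig_mx N ->
  is_trig_mx (M *m N) /\ (forall i, (M *m N) i i = M i i * N i i).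
Proof.
move=> /is_trig_mxP tM /is_trig_mxP tN; split.
  apply/is_trig_mxP => i j ij; rewrite mxE big1 // => k _.
  case: (ltnP i k) => [ik|ki]; first by rewrite tM ?mul0r.
  by rewrite tN ?mulr0 // (leq_ltn_trans ki).
move=> i; rewrite mxE (bigD1 i) //= big1 ?addr0 // => k ki.
case: (ltnP i k) => [ik|ik]; first by rewrite tM ?mul0r.
by rewrite tN ?mulr0 // ltn_neqAle ik andbT.
Qed.

Lemma trig_mxX (A : pzRingType) n (M : 'M[A]_n) f :
  is_trig_mx M -> is_trig_mx (M ^+ f) /\ (forall i, (M ^+ f) i i = M i i ^+ f).
Proof.
move=> tM; elim: f => [|f [IHt IHd]].
  rewrite expr0; split; first exact: scalar_mx_is_trig.
  by move=> i; rewrite expr0 mxE eqxx.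
rewrite exprS; have [tMf dMf] := trig_mxM tM IHt; split => // i.
by rewrite dMf IHd -exprS.
Qed.

(** Conjugating F to a triangular matrix, the list consists of the diagonal
    entries; powers, traces and determinants of triangular matrices are read
    off the diagonal. *)
Lemma eigenvalues_trace_det (C : numClosedFieldType) n (F : 'M[C]_n) :
  exists s : seq C,
    (forall f, \tr (F ^+ f) = \sum_(x <- s) x ^+ f) /\
    \det (1%:M - 'X *: map_mx polyC F) = \prod_(x <- s) (1 - x *: 'X).
Proof.
case: (posnP n) => [n0|n_gt0].
  exists [::]; move: F; rewrite n0 => F; split; last by rewrite det_mx00 big_nil.
  by move=> f; rewrite big_nil /mxtrace big_ord0.
have [P Pu] := Schur F n_gt0; have {}Pu := unitarymx_unit Pu.
rewrite /similar_to conjumx // => tT; set T := P *m F *m invmx P in tT.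
exists [seq T i i | i : 'I_n]; split.
  move=> f; have -> : \tr (F ^+ f) = \tr (T ^+ f).
    have -> : T ^+ f = P *m F ^+ f *m invmx P.
      elim: f => [|f IH]; first by rewrite !expr0 mulmx1 mulmxV.
      by rewrite exprS IH exprS /T -!mulmxE !mulmxA mulmxKV.
    by rewrite mxtrace_mulC mulmxA mulVmx ?mul1mx.
  rewrite big_map big_enum /=; apply: eq_bigr => i _.
  by case: (trig_mxX f tT).
have -> : \det (1%:M - 'X *: map_mx polyC F) = \det (1%:M - 'X *: map_mx polyC T).
  have -> : 1%:M - 'X *: map_mx polyC T =
    map_mx polyC P *m (1%:M - 'X *: map_mx polyC F) *m map_mx polyC (invmx P).
    rewrite mulmxBr mulmxBl mulmx1 -map_mxM mulmxV // map_mx1; congr (_ - _).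
    by rewrite -scalemxAr -scalemxAl /T !map_mxM.
  rewrite !det_mulmx mulrAC -det_mulmx -map_mxM mulmxV //.
  by rewrite map_mx1 det1 mul1r.
clearbody T; rewrite det_trig.
  rewrite big_map big_enum /=; apply: eq_bigr => i _.
  by rewrite !mxE eqxx mulrC mul_polyC.
apply/is_trig_mxP => i j ij; move/is_trig_mxP: tT => tT.
by rewrite !mxE tT // polyC0 mulr0 subr0 (negPf (_ : i != j)) // neq_ltn ij.
Qed.

Lemma trace_formula_newton r (h : nat -> int) : trace_formula r h ->
  exists L : {poly int}, L`_0 = 1 /\
    forall n, n.+1%:R * L`_n.+1 = - \sum_(i < n.+1) h i.+1 * L`_(n - i).
Proof.
move=> [F [trF [L _ LE]]]; exists L.
have [s [trs dets]] := eigenvalues_trace_det F.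
have LC k : (L`_k)%:~R = (\prod_(x <- s) (1 - x *: 'X))`_k.
  by rewrite -dets -LE coef_map.
split.
  apply: (@intr_inj algC); rewrite LC -horner_coef0 horner_prod.
  by rewrite big1 // => x _; rewrite hornerD hornerN hornerZ hornerX hornerC mulr0 subr0.
move=> n; apply: (@intr_inj algC).
rewrite rmorphM rmorphN rmorph_sum /= LC rmorph_nat newton_identity; congr (- _).
by apply: eq_bigr => i _; rewrite rmorphM /= LC trF // trs.
Qed.

(** The formal local factor is the reversed characteristic polynomial of
    Frobenius: both satisfy Newton's recurrence.  Hence it has integral
    coefficients. *)
Lemma fps_exp_trace r (h : nat -> int) : trace_formula r h ->
  exists L : {poly int}, [/\ L`_0 = 1,
    forall n, n.+1%:R * L`_n.+1 = - \sum_(i < n.+1) h i.+1 * L`_(n - i)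
  & forall n, fps_exp (fun f => if f == 0%N then 0 else - ((h f)%:~R / f%:R)) n =
              (L`_n)%:~R].
Proof.
move=> /trace_formula_newton[L [L0 LS]]; exists L; split=> // n.
apply: (@log_recurrence_unique (fun i => - (h i.+1)%:~R) _ (fun n => (L`_n)%:~R) n).
- exact: fps_exp0.
- by rewrite L0.
- move=> m _; rewrite fps_expS //; apply: eq_bigr => i _; congr (_ * _).
  by rewrite /= mulrN mulrCA mulfV ?mulr1 // pnatr_eq0.
- move=> m _; have /(congr1 (fun x : int => x%:~R : rat)) := LS m.
  rewrite /= rmorphM rmorphN rmorph_sum rmorph_nat => ->.
  by rewrite -sumrN; apply: eq_bigr => i _; rewrite rmorphM mulNr.
- exact: leqnn.
Qed.

(** * Euler products *)

(** In the convolution of the factor at p with the product over the other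
    primes, only the divisor d = p^(logn p n) contributes: the first factor
    forces d to be a power of p, the second forces n / d to be prime to p. *)
Lemma dirichlet_local_prod (u : nat -> nat -> rat) (ps : seq nat) n :
  uniq ps -> all prime ps -> (forall p, p \in ps -> u p 0%N = 1) -> (0 < n)%N ->
  (\big[dirichlet_mul/dirichlet_one]_(p <- ps) dirichlet_local p (u p)) n =
  if all [in ps] (primes n) then \prod_(p <- ps) u p (logn p n) else 0.
Proof.
elim: ps n => [|p ps IH] n /=.
  move=> _ _ _ n_gt0; rewrite !big_nil /dirichlet_one.
  have -> : all [in [::]] (primes n) = (n == 1%N); last by case: eqP.
  apply/idP/eqP => [|->//]; case E: (primes n) => //= _.
  by apply/eqP; rewrite eqn_leq n_gt0 andbT -ltnS -primes_eq0 E.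
move=> /andP[p_ps ps_uniq] /andP[p_pr ps_pr] u0 n_gt0.
rewrite !big_cons; set V := \big[_/_]_(_ <- ps) _ in IH *; rewrite /dirichlet_mul.
have [m pm Dn] := pfactor_coprime p_pr n_gt0.
have {}IH k : (0 < k)%N -> V k =
    if all [in ps] (primes k) then \prod_(p <- ps) u p (logn p k) else 0.
  by move=> k0; apply: IH => // p' p'ps; apply: u0; rewrite inE p'ps orbT.
have m_gt0 : (0 < m)%N by move: n_gt0; rewrite Dn muln_gt0 => /andP[].
set k := logn p n in Dn *.
rewrite (bigD1_seq (p ^ k)%N) ?divisors_uniq //=; last first.
  by rewrite -dvdn_divisors // Dn dvdn_mull.
rewrite [X in _ + X]big1_seq ?addr0 => [|d /andP[d_neq]]; last first.
  rewrite -dvdn_divisors // /dirichlet_local => d_n.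
  case: eqP => [Dd|_]; last by rewrite mul0r.
  have d_gt0 := dvdn_gt0 n_gt0 d_n.
  have nd_gt0 : (0 < n %/ d)%N by rewrite divn_gt0 // dvdn_leq.
  rewrite IH //; case: ifP => [/allP sub|_]; last by rewrite mulr0.
  suff /sub : p \in primes (n %/ d) by rewrite /= (negPf p_ps).
  rewrite mem_primes p_pr nd_gt0 /= -[p]expn1 pfactor_dvdn // logn_div // subn_gt0.
  have := dvdn_leq_log p n_gt0 d_n; rewrite leq_eqVlt => /predU1P[e|//].
  by case/eqP: d_neq; rewrite Dd e.
rewrite /dirichlet_local pfactorK // eqxx {1}Dn mulnK ?expn_gt0 ?prime_gt0 //.
rewrite IH //.
have logm q : q != p -> logn q m = logn q n.
  move=> qp; have pk_gt0 : (0 < p ^ k)%N by rewrite expn_gt0 prime_gt0.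
  rewrite Dn lognM // lognX (_ : logn q p = 0%N) ?muln0 ?addn0 //.
  have [q_pr|q_npr] := boolP (prime q); first by rewrite logn_prime // (negPf qp).
  by rewrite lognE (negPf q_npr).
rewrite [X in _ = if X then _ else _](_ : _ = all [in ps] (primes m)); last first.
  apply/allP/allP => sub q q_pm.
    have q_p : q != p.
      apply: contraTneq q_pm => ->; rewrite mem_primes p_pr m_gt0 /=.
      by rewrite -prime_coprime.
    have /= := sub q; rewrite inE (negPf q_p); apply.
    move: q_pm; rewrite !mem_primes n_gt0 m_gt0 /= => /andP[-> q_m].
    by rewrite Dn dvdn_mulr.
  rewrite inE /=; case: eqP => //= /eqP q_p; apply: sub.
  move: q_pm; rewrite !mem_primes n_gt0 m_gt0 /= => /andP[q_pr].
  by rewrite q_pr -[q]expn1 !pfactor_dvdn // logm.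
case: ifP => _; last by rewrite mulr0.
congr (_ * _); apply: eq_big_seq => q q_ps; rewrite logm //.
by apply: contraNneq p_ps => <-.
Qed.

(** A bound N independent of n allows the products for two different n to be
    compared factor by factor. *)
Lemma euler_productE (u : nat -> nat -> rat) n N :
  (forall p, prime p -> u p 0%N = 1) -> (0 < n <= N)%N ->
  euler_product u n = \prod_(p <- [seq p <- index_iota 0 N.+1 | prime p]) u p (logn p n).
Proof.
move=> u0 /andP[n_gt0 nN]; rewrite /euler_product.
rewrite -(big_mkord prime (fun p => dirichlet_local p (u p))) -big_filter.
rewrite dirichlet_local_prod ?filter_uniq ?iota_uniq //; first last.
- by move=> p; rewrite mem_filter => /andP[/u0].
- exact: filter_all.
rewrite ifT; last first.
  apply/allP => p; rewrite mem_primes /= mem_filter mem_iota ltnS.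
  by case/and3P=> p_pr _ pn; rewrite p_pr prime_gt0 //= dvdn_leq.
rewrite !big_filter [RHS](@big_cat_nat _ _ _ n.+1) //=.
rewrite [X in _ = _ * X]big_nat_cond [X in _ = _ * X]big1 ?mulr1 //.
move=> p /andP[/andP[np _] p_pr]; rewrite (_ : logn p n = 0%N) ?u0 //.
by apply/eqP; rewrite -leqn0 leqNgt -pfactor_dvdn // expn1 gtnNdvd.
Qed.

Lemma euler_product1 (u : nat -> nat -> rat) :
  (forall p, prime p -> u p 0%N = 1) -> euler_product u 1 = 1.
Proof.
by move=> u0; rewrite (euler_productE (N := 1)) // big_filter big1 // => p p_pr; rewrite logn1 u0.
Qed.

Lemma euler_product_coprime (u : nat -> nat -> rat) p k m :
  (forall p, prime p -> u p 0%N = 1) -> prime p -> (0 < k)%N -> (0 < m)%N ->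
  coprime p m -> euler_product u (p ^ k * m) = u p k * euler_product u m.
Proof.
move=> u0 p_pr k_gt0 m_gt0 pm; set N := (p ^ k * m)%N.
have pk_gt0 : (0 < p ^ k)%N by rewrite expn_gt0 prime_gt0.
have N_gt0 : (0 < N)%N by rewrite muln_gt0 pk_gt0.
have pN : (p <= N)%N by rewrite dvdn_leq // dvdn_mulr // -(prednK k_gt0) expnS dvdn_mulr.
rewrite (euler_productE (N := N)) ?N_gt0 ?leqnn //.
rewrite (euler_productE (n := m) (N := N)) //; last first.
  by rewrite m_gt0 leq_pmull.
set ps := [seq q <- _ | _].
have p_ps : p \in ps by rewrite mem_filter p_pr mem_index_iota ltnS.
have ps_uniq : uniq ps by rewrite filter_uniq ?iota_uniq.
rewrite (bigD1_seq p) //= [in RHS](bigD1_seq p) //=.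
have p_m : logn p m = 0%N.
  by apply/eqP; rewrite -leqn0 leqNgt -pfactor_dvdn // expn1 -prime_coprime // pm.
rewrite p_m u0 // mul1r lognM // pfactorK // p_m addn0; congr (_ * _).
rewrite big_seq_cond [RHS]big_seq_cond; apply: eq_bigr => q /andP[].
rewrite mem_filter => /andP[q_pr _] qp.
by rewrite lognM // lognX logn_prime // (negPf qp) muln0.
Qed.

Lemma euler_product_prime_power (u : nat -> nat -> rat) p k :
  (forall p, prime p -> u p 0%N = 1) -> prime p -> (0 < k)%N ->
  euler_product u (p ^ k) = u p k.
Proof.
move=> u0 p_pr k_gt0; rewrite -[(p ^ k)%N]muln1.
by rewrite euler_product_coprime ?coprimen1 // euler_product1 ?mulr1.
Qed.

Lemma euler_product_split (u : nat -> nat -> rat) p n :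
  (forall p, prime p -> u p 0%N = 1) -> prime p -> (0 < n)%N -> (p %| n)%N ->
  let q := (p ^ logn p n)%N in
  euler_product u n = euler_product u q * euler_product u (n %/ q).
Proof.
move=> u0 p_pr n_gt0 pn q; have [m pm Dn] := pfactor_coprime p_pr n_gt0.
have k_gt0 : (0 < logn p n)%N by rewrite -pfactor_dvdn ?expn1.
have q_gt0 : (0 < q)%N by rewrite expn_gt0 prime_gt0.
have m_gt0 : (0 < m)%N by move: n_gt0; rewrite Dn muln_gt0 => /andP[].
rewrite {1 2}Dn -/q mulnK // mulnC /q euler_product_coprime // euler_product_prime_power //.
Qed.

(** * Running a program within a time bound *)

Definition runs (c : cmd) (m : memory) (t : nat) (Q : memory -> Prop) : Prop :=
  exists t' m', [/\ exec c m t' m', (t' <= t)%N & Q m'].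

Lemma runs_weaken c m t t' (Q Q' : memory -> Prop) :
  runs c m t Q -> (t <= t')%N -> (forall m', Q m' -> Q' m') -> runs c m t' Q'.
Proof.
move=> [u [m' [ex ut Qm]]] tt' QQ'; exists u, m'; split; auto.
exact: leq_trans tt'.
Qed.

Lemma runs_skip m t (Q : memory -> Prop) : Q m -> (0 < t)%N -> runs Skip m t Q.
Proof. by move=> Qm t0; exists 1%N, m; split => //; exact: ExecSkip. Qed.

Lemma runs_write a i e m t (Q : memory -> Prop) :
  Q (mem_upd m a (expr_eval m i) (expr_eval m e)) ->
  (expr_cost i + expr_cost e < t)%N -> runs (Write a i e) m t Q.
Proof. by move=> Qm tt; eexists; eexists; split; [exact: ExecWrite|..]. Qed.

Lemma runs_seq t1 t2 c1 c2 m t (Q : memory -> Prop) :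
  runs c1 m t1 (fun m1 => runs c2 m1 t2 Q) -> (t1 + t2 < t)%N ->
  runs (Seq c1 c2) m t Q.
Proof.
move=> [u1 [m1 [ex1 le1 [u2 [m2 [ex2 le2 Qm]]]]]] tt.
eexists; eexists; split; [exact: ExecSeq ex1 ex2 | | exact: Qm].
by rewrite (leq_trans _ tt) // ltnS leq_add.
Qed.

Lemma runs_if t' e c1 c2 m t (Q : memory -> Prop) :
  runs (if expr_eval m e != 0 then c1 else c2) m t' Q ->
  (expr_cost e + t' < t)%N -> runs (If e c1 c2) m t Q.
Proof.
move=> [u [m1 [ex le Qm]]] tt.
eexists; eexists; split; [exact: ExecIf ex | | exact: Qm].
by rewrite (leq_trans _ tt) // ltnS leq_add2l.
Qed.

Lemma runs_call t' c es a i m t (Q : memory -> Prop) :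
  runs c (mem_init [seq expr_eval m e | e <- es] (fun=> 0)) t'
    (fun m1 => Q (mem_upd m a (expr_eval m i) (mem_out m1 0))) ->
  (sumn [seq expr_cost e | e <- es] + expr_cost i + t' < t)%N ->
  runs (Call c es a i) m t Q.
Proof.
move=> [u [m1 [ex le Qm]]] tt.
eexists; eexists; split; [exact: ExecCall ex | | exact: Qm].
by rewrite (leq_trans _ tt) // ltnS leq_add2l.
Qed.

(** All loops of the program have a number of iterations that is known in
    advance from the values they compute, so an invariant indexed by the
    iteration serves both correctness and timing. *)
Lemma runs_for (I : nat -> memory -> Prop) (t : nat -> nat) e c lo hi m T :
  (lo <= hi)%N -> I lo m ->
  (forall i m, (lo <= i < hi)%N -> I i m ->
     expr_eval m e != 0 /\ runs c m (t i) (I i.+1)) ->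
  (forall m, I hi m -> expr_eval m e = 0) ->
  (\sum_(lo <= i < hi) (expr_cost e + t i).+1 + expr_cost e < T)%N ->
  runs (While e c) m T (I hi).
Proof.
move=> lohi Ilo step stop TT; suff [u [m' [ex ut Im']]] :
    runs (While e c) m (\sum_(lo <= i < hi) (expr_cost e + t i).+1 + (expr_cost e).+1) (I hi).
  by exists u, m'; split => //; rewrite (leq_trans ut) // addnS.
move Dk: (hi - lo)%N => k; elim: k lo m lohi Ilo step Dk {TT} => [|k IH] lo m lohi Ilo step Dk.
  have Dlo : lo = hi by apply/eqP; rewrite eqn_leq lohi /= -subn_eq0 Dk.
  rewrite Dlo in Ilo *; rewrite big_geq //.
  by eexists; eexists; split; [exact: ExecWhileStop (stop _ Ilo)|..].
have {}lohi : (lo < hi)%N by rewrite -subn_gt0 Dk.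
have [|ne0 [u1 [m1 [ex1 le1 I1]]]] := step lo m _ Ilo; first by rewrite leqnn.
have [||u2 [m2 [ex2 le2 I2]]] := IH lo.+1 m1 lohi I1.
- by move=> i m' /andP[loi ihi]; apply: step; rewrite (ltnW loi).
- by rewrite subnS Dk.
eexists; eexists; split; [exact: ExecWhileStep ne0 ex1 ex2 | | exact: I2].
rewrite big_ltn // -[X in (_ <= X)%N]addnA [X in (_ <= X)%N]addSn ltnS.
exact: leq_add (leq_add (leqnn _) le1) le2.
Qed.

Definition frame (s : seq nat) (m m' : memory) : Prop :=
  forall a i, a \notin s -> m' a i = m a i.

Lemma frame_trans s m m1 m2 : frame s m m1 -> frame s m1 m2 -> frame s m m2.
Proof. by move=> f1 f2 a i as_; rewrite f2 ?f1. Qed.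

Lemma frame_upd (s : seq nat) m a i v : a \in s -> frame s m (mem_upd m a i v).
Proof.
move=> as_ a' i' a's; rewrite /mem_upd ifN // negb_and.
by rewrite (_ : a' != a) //; apply: contraNneq a's => ->.
Qed.

Lemma frame_sub (s s' : seq nat) m m' :
  {subset s <= s'} -> frame s m m' -> frame s' m m'.
Proof. by move=> ss' f a i as'; apply: f; apply: contra as'; apply: ss'. Qed.

Lemma mem_updE m a i v a' i' :
  mem_upd m a i v a' i' = if (a' == a) && (i' == i) then v else m a' i'.
Proof. by []. Qed.

(** * Trial division and convolution on the machine *)

(** Arrays 0 to 2 follow the calling convention.  The arrays local_arr and
    trace_arr are indexed by the prime powers themselves: cell p^k of the first
    holds the k-th coefficient of L_p, of the second the trace for p^k.  The
    cell p of bad_arr is 1 when p is bad.  The registers are the zeroth cells of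
    the remaining arrays. *)
Local Notation arg_arr := 0%N.
Local Notation table_arr := 1%N.
Local Notation coef_arr := 2%N.
Local Notation local_arr := 3%N.
Local Notation trace_arr := 4%N.
Local Notation bad_arr := 5%N.
Local Notation n_reg := 6%N.
Local Notation d_reg := 7%N.
Local Notation m_reg := 8%N.
Local Notation k_reg := 9%N.
Local Notation acc_reg := 10%N.
Local Notation f_reg := 11%N.

Local Notation reg v := (Read v (Cst 0)).
Local Notation assign v e := (Write v (Cst 0) e).

Definition smallest_factor_cmd : cmd :=
  Seq (assign d_reg (Cst 2))
 (Seq (While (Bin OpMul (Bin OpLe (Bin OpMul (reg d_reg) (reg d_reg)) (reg n_reg))
                        (Bin OpRem (reg n_reg) (reg d_reg)))
         (assign d_reg (Bin OpAdd (reg d_reg) (Cst 1))))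
      (If (Bin OpLe (Bin OpMul (reg d_reg) (reg d_reg)) (reg n_reg))
          Skip (assign d_reg (reg n_reg)))).

(** The search stops at the least d > 1 with n < d^2 or d dividing n.  If d^2 <= n
    it is the smallest prime factor; otherwise n is prime. *)
Lemma runs_smallest_factor n s m :
  (1 < n)%N -> (n < s.+1 ^ 2)%N -> m n_reg 0 = n%:Z ->
  runs smallest_factor_cmd m (50 * s.+1)
    (fun m' => m' d_reg 0 = (pdiv n)%:Z /\ frame [:: d_reg] m m').
Proof.
move=> n_gt1 ns mn; have n_gt0 := ltnW n_gt1.
have s_gt0 : (0 < s)%N by case: s ns => //; rewrite ltnNge n_gt0.
pose stop d := (1 < d)%N && ((n < d * d)%N || (d %| n)%N).
(* s + 1 is a stopping point, which bounds the number of trials. *)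
have stop_ex : exists d, stop d by exists s.+1; rewrite /stop ltnS s_gt0 mulnn ns.
case: (ex_minnP stop_ex) => b /andP[b_gt1 b_stop] b_min.
have b_le : (b <= s.+1)%N by apply: b_min; rewrite /stop ltnS s_gt0 mulnn ns.
have run_d d : (1 < d < b)%N -> (d * d <= n)%N && ~~ (d %| n)%N.
  move=> /andP[d1 db]; rewrite leqNgt -negb_or; apply/negP => dn.
  by have := b_min d; rewrite /stop d1 dn leqNgt db => /(_ isT).
pose I i m' := m' d_reg 0 = i%:Z /\ frame [:: d_reg] m m'.
have In i m' : I i m' -> m' n_reg 0 = n%:Z by case=> _ ->.
have evI i m' : I i m' ->
    expr_eval m' (Bin OpMul (Bin OpLe (Bin OpMul (reg d_reg) (reg d_reg)) (reg n_reg))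
                            (Bin OpRem (reg n_reg) (reg d_reg))) =
    ((i * i <= n) * (n %% i))%N%:Z.
  by move=> Im /=; rewrite (In _ _ Im) (proj1 Im) modz_nat.
apply: (@runs_seq 4 (50 * s.+1 - 5)); last by lia.
apply: runs_write => //=.
apply: (@runs_seq (30 * s.+1) 20); last by lia.
apply: (@runs_weaken _ _ (30 * s.+1) _ (I b)) => //.
  apply: (@runs_for I (fun=> 8%N) _ _ 2%N b) => //.
  - by split; [rewrite mem_updE eqxx | apply: frame_upd; rewrite inE].
  - move=> i m' ib Im'; have /andP[ii nii] := run_d i ib; split.
      by rewrite (evI i) // ii mul1n -lt0n lt0n.
    apply: runs_write => //=; split; last first.
      by apply: frame_trans (proj2 Im') _; apply: frame_upd; rewrite inE.
    by rewrite mem_updE /= (proj1 Im') -addn1 PoszD.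
  - move=> m' Im'; rewrite (evI b) //; case/orP: b_stop => [|/eqP ->].
      by rewrite ltnNge => /negPf ->.
    by rewrite muln0.
  - by rewrite sum_nat_const_nat /=; lia.
move=> m' Im'; apply: (@runs_if 10) => //=.
rewrite (In _ _ Im') (proj1 Im') -PoszM lez_nat.
have [bn|nb] := leqP (b * b) n => /=.
  have {b_stop} bn' : (b %| n)%N by move: b_stop; rewrite ltnNge bn.
  apply: runs_skip => //; split; last exact: proj2 Im'.
  rewrite (proj1 Im'); congr Posz; apply/eqP; rewrite eqn_leq pdiv_min_dvd // andbT.
  by apply: b_min; rewrite /stop prime_gt1 ?pdiv_prime // pdiv_dvd orbT.
apply: runs_write => //=; split; last first.
  by apply: frame_trans (proj2 Im') _; apply: frame_upd; rewrite inE.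
rewrite mem_updE eqxx (In _ _ Im') pdiv_id //; apply: ltn_pdiv2_prime => //.
rewrite (leq_trans nb) // -mulnn leq_mul //;
  by apply: b_min; rewrite /stop prime_gt1 ?pdiv_prime // pdiv_dvd orbT.
Qed.

Definition factor_out_cmd : cmd :=
  Seq (assign m_reg (reg n_reg))
 (Seq (assign k_reg (Cst 0))
      (While (Bin OpEq (Bin OpRem (reg m_reg) (reg d_reg)) (Cst 0))
         (Seq (assign m_reg (Bin OpQuo (reg m_reg) (reg d_reg)))
              (assign k_reg (Bin OpAdd (reg k_reg) (Cst 1)))))).

Lemma runs_factor_out n p m :
  (0 < n)%N -> prime p -> m n_reg 0 = n%:Z -> m d_reg 0 = p%:Z ->
  runs factor_out_cmd m (50 * (logn p n).+1)
    (fun m' => [/\ m' m_reg 0 = (n %/ p ^ logn p n)%N%:Z,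
                   m' k_reg 0 = (logn p n)%:Z & frame [:: m_reg; k_reg] m m']).
Proof.
move=> n_gt0 p_pr mn mp; set k := logn p n.
pose I i m' := [/\ m' m_reg 0 = (n %/ p ^ i)%N%:Z, m' k_reg 0 = i%:Z
                 & frame [:: m_reg; k_reg] m m'].
have dvd i : (i <= k)%N -> (p %| n %/ p ^ i)%N = (i < k)%N.
  move=> ik; have pin : (p ^ i %| n)%N by rewrite pfactor_dvdn.
  have pi_gt0 : (0 < p ^ i)%N by rewrite expn_gt0 prime_gt0.
  have q_gt0 : (0 < n %/ p ^ i)%N by rewrite divn_gt0 //; apply: dvdn_leq.
  by rewrite -[p in LHS]expn1 pfactor_dvdn // logn_div // pfactorK // subn_gt0.
have evI i m' : (i <= k)%N -> I i m' ->
    expr_eval m' (Bin OpEq (Bin OpRem (reg m_reg) (reg d_reg)) (Cst 0)) = (i < k)%N%:Z.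
  move=> ik [/= -> _ fr]; rewrite fr // mp modz_nat eqz_nat -dvd //.
apply: (@runs_seq 5 (50 * k.+1 - 6)); last by lia.
apply: runs_write => //=.
apply: (@runs_seq 5 (30 * k.+1)); last by lia.
apply: runs_write => //=.
apply: (@runs_for I (fun=> 20%N) _ _ 0%N k) => //.
- split; rewrite ?mem_updE //= ?eqxx ?expn0 ?divn1 //.
  by apply: frame_trans (frame_upd _ _ _ _) (frame_upd _ _ _ _); rewrite !inE.
- move=> i m' /andP[_ ik] Im'; split; first by rewrite (evI i) ?ik // ltnW.
  case: (Im') => Im Ik fr.
  apply: (@runs_seq 9 8) => //; apply: runs_write => //=.
  apply: runs_write => //=; split; last first.
  + apply: frame_trans fr _.
    by apply: frame_trans (frame_upd _ _ _ _) (frame_upd _ _ _ _); rewrite !inE.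
  + by rewrite mem_updE /= mem_updE /= Ik -addn1 PoszD.
  rewrite mem_updE /= mem_updE /= Im fr // mp divz_nat expnSr divnMA //.
- by move=> m' Im'; rewrite (evI k) // ltnn.
- by rewrite sum_nat_const_nat /=; lia.
Qed.

Definition convolution_cmd (A B : nat) : cmd :=
  Seq (assign acc_reg (Cst 0))
 (Seq (assign f_reg (reg d_reg))
      (While (Bin OpLe (reg f_reg) (reg n_reg))
         (Seq (assign acc_reg (Bin OpSub (reg acc_reg)
                 (Bin OpMul (Read A (reg f_reg))
                            (Read B (Bin OpQuo (reg n_reg) (reg f_reg))))))
              (assign f_reg (Bin OpMul (reg f_reg) (reg d_reg)))))).

(** With n = p^(k+1), the register f runs through p, p^2, ..., n; cell n / f of
    the second array is then the one of the complementary exponent. *)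
Lemma runs_convolution A B p k m :
  A \notin [:: acc_reg; f_reg] -> B \notin [:: acc_reg; f_reg] ->
  prime p -> m n_reg 0 = (p ^ k.+1)%N%:Z -> m d_reg 0 = p%:Z ->
  runs (convolution_cmd A B) m (100 * k.+2)
    (fun m' => m' acc_reg 0 =
         - (\sum_(i < k.+1) m A (p ^ i.+1)%N%:Z * m B (p ^ (k - i))%N%:Z)
       /\ frame [:: acc_reg; f_reg] m m').
Proof.
move=> hA hB p_pr mn mp; have p_gt0 := prime_gt0 p_pr.
pose I i m' := [/\ m' acc_reg 0 =
     - (\sum_(j < i) m A (p ^ j.+1)%N%:Z * m B (p ^ (k - j))%N%:Z),
   m' f_reg 0 = (p ^ i.+1)%N%:Z & frame [:: acc_reg; f_reg] m m'].
have evI i m' : I i m' -> expr_eval m' (Bin OpLe (reg f_reg) (reg n_reg)) = (i < k.+1)%N%:Z.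
  by move=> [_ /= -> fr]; rewrite fr // mn lez_nat leq_exp2l // prime_gt1.
apply: (@runs_seq 4 (100 * k.+2 - 5)); last by lia.
apply: runs_write => //=.
apply: (@runs_seq 5 (60 * k.+2)); last by lia.
apply: runs_write => //=.
apply: (@runs_weaken _ _ (60 * k.+2) _ (I k.+1)) => //; last by move=> m' [].
apply: (@runs_for I (fun=> 40%N) _ _ 0%N k.+1) => //.
- split; rewrite ?mem_updE /= ?mem_updE /= ?mp ?expn1 ?big_ord0 ?oppr0 //.
  by apply: frame_trans (frame_upd _ _ _ _) (frame_upd _ _ _ _); rewrite !inE.
- move=> i m' /andP[_ ik] Im'; split; first by rewrite (evI i) // ik.
  case: (Im') => Iacc If_ fr.
  apply: (@runs_seq 20 10) => //; apply: runs_write => //=.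
  apply: runs_write => //=; split; last first.
  + apply: frame_trans fr _.
    by apply: frame_trans (frame_upd _ _ _ _) (frame_upd _ _ _ _); rewrite !inE.
  + by rewrite mem_updE /= !mem_updE /= If_ fr // mp -PoszM [in RHS]expnSr.
  rewrite mem_updE /= mem_updE /= Iacc If_ !fr // mn divz_nat big_ord_recr /= opprD.
  by rewrite -expnB // subSS.
- by move=> m' Im'; rewrite (evI k.+1) // ltnn.
- by rewrite sum_nat_const_nat /=; lia.
Qed.

(** * The program for the Dirichlet coefficients *)

Lemma prime_power_inj p q j k :
  prime p -> prime q -> (0 < k)%N -> (p ^ j)%N = (q ^ k)%N -> p = q /\ j = k.
Proof.
move=> p_pr q_pr k_gt0 e; have q_p : q = p.
  have : (q %| p ^ j)%N by rewrite e -(prednK k_gt0) expnS dvdn_mulr.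
  by rewrite Euclid_dvdX // dvdn_prime2 // => /andP[/eqP].
split=> //; rewrite q_p in e; exact: expnI (prime_gt1 p_pr) _ _ e.
Qed.

(** Newton's recurrence at n = p^k for a good prime p; the local factors at bad
    primes are stored beforehand.  The command E evaluates traces, whose values
    for k = 1 are part of the input. *)
Definition local_factor_cmd (E : cmd) : cmd :=
  If (Read bad_arr (reg d_reg)) Skip
    (Seq (If (Bin OpEq (reg k_reg) (Cst 1))
            (Write trace_arr (reg n_reg) (Read table_arr (reg n_reg)))
            (Call E [:: reg d_reg; reg k_reg] trace_arr (reg n_reg)))
    (Seq (convolution_cmd trace_arr local_arr)
         (Write local_arr (reg n_reg) (Bin OpQuo (reg acc_reg) (reg k_reg))))).

Definition coefficient_cmd (E : cmd) : cmd :=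
  Seq smallest_factor_cmd
 (Seq factor_out_cmd
 (Seq (If (Bin OpEq (reg m_reg) (Cst 1))
         (Seq (local_factor_cmd E)
         (Seq (convolution_cmd local_arr coef_arr)
              (Write coef_arr (reg n_reg) (reg acc_reg))))
         (Write coef_arr (reg n_reg)
            (Bin OpMul (Read coef_arr (Bin OpQuo (reg n_reg) (reg m_reg)))
                       (Read coef_arr (reg m_reg)))))
      (assign n_reg (Bin OpAdd (reg n_reg) (Cst 1))))).

Section Coefficients.

Variables (good : pred nat) (H l : nat -> nat -> int) (a : nat -> int).
Variables (X : nat) (table : nat -> int) (E : cmd) (C : nat).

Hypothesis tableE : forall p, prime p -> good p -> (p <= X)%N -> table p = H p 1%N.
Hypothesis callE : forall p f, prime p -> good p -> (0 < f)%N ->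
  runs E (mem_init [:: p%:Z; f%:Z] (fun=> 0)) (C * (f * p ^ f))
    (fun m => mem_out m 0 = H p f).
Hypothesis l_rec : forall p k, prime p -> good p ->
  k.+1%:Z * l p k.+1 = - \sum_(i < k.+1) H p i.+1 * l p (k - i).
Hypothesis a_prime_power : forall p k, prime p ->
  a (p ^ k.+1) = - \sum_(i < k.+1) l p i.+1 * a (p ^ (k - i)).
Hypothesis a_split : forall p n, prime p -> (0 < n)%N -> (p %| n)%N ->
  a n = a (p ^ logn p n) * a (n %/ p ^ logn p n).

(** What the memory holds when the coefficients below n have been computed.
    The second bound n' moves ahead of n while a prime power n is treated: the
    local factor is extended to n before the coefficient a n is found.  The
    local factors at bad primes are there from the start. *)
Record state (n n' : nat) (m : memory) : Prop := State {
  state_n : m n_reg 0 = n%:Z;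
  state_arg : m arg_arr 0 = X%:Z;
  state_table : forall i : nat, m table_arr i%:Z = table i;
  state_bad : forall p, prime p -> m bad_arr p%:Z = (~~ good p)%:Z;
  state_coef : forall i, (0 < i < n)%N -> m coef_arr i%:Z = a i;
  state_trace : forall p j, prime p -> good p -> (0 < j)%N -> (p ^ j < n')%N ->
    m trace_arr (p ^ j)%N%:Z = H p j;
  state_local : forall p j, prime p -> (p ^ j < n')%N || ~~ good p ->
    m local_arr (p ^ j)%N%:Z = l p j
}.

Lemma state_frame n n' m m' :
  frame [:: d_reg; m_reg; k_reg; acc_reg; f_reg] m m' ->
  state n n' m -> state n n' m'.
Proof.
move=> fr [sn sa st sb sc str sl].
by split=> *; rewrite fr //; auto.
Qed.

(** The convolution accumulates k + 1 times the new coefficient, by Newton's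
    recurrence, so that the integer division is exact.  An evaluation of the
    trace is charged only for a proper prime power. *)
Lemma runs_local_factor p k m (n := (p ^ k.+1)%N) :
  prime p -> (n <= X)%N -> state n n m ->
  m d_reg 0 = p%:Z -> m k_reg 0 = k.+1%:Z ->
  runs (local_factor_cmd E) m
    (200 * k.+2 + C * (if k == 0%N then 0 else k.+1 * n))
    (fun m' => state n n.+1 m' /\ frame [:: local_arr; trace_arr; acc_reg; f_reg] m m').
Proof.
move=> p_pr nX st md mk; have [sn sa stb sb sc str sl] := st.
(* n is a power of no other prime, so its cell belongs to p alone. *)
have npow q j : prime q -> (q ^ j < n.+1)%N -> (q ^ j < n)%N \/ q = p /\ j = k.+1.
  move=> q_pr; rewrite ltnS leq_eqVlt => /predU1P[|->]; last by left.
  by move/prime_power_inj => e; right; apply: e.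
set T := (if _ then _ else _).
apply: (@runs_if (200 * k.+2 + C * T - 4)) => /=; last by lia.
rewrite md sb //; have [g|ng] := boolP (good p) => /=; last first.
  apply: runs_skip; last by lia.
  split=> //; split=> // q j q_pr.
    move=> g j_gt0 /(npow q j q_pr)[qn|[qp _]]; first exact: str.
    by rewrite -qp g in ng.
  case/orP => [/(npow q j q_pr)[qn|[qp _]]|q_bad]; apply: sl => //.
  - by rewrite qn.
  - by rewrite qp ng orbT.
  - by rewrite q_bad orbT.
pose m1 := mem_upd m trace_arr n%:Z (H p k.+1).
apply: (@runs_seq (C * T + 20) (150 * k.+2)); last by lia.
apply: (@runs_weaken _ _ (C * T + 20) _ (eq m1)) => //.
  apply: (@runs_if (C * T + 14)) => /=; last by lia.
  rewrite mk (_ : (k.+1%:Z == 1) = (k == 0%N)) //.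
  have [k0|k_neq0] := eqVneq k 0%N.
    have np : n = p by rewrite /n k0 expn1.
    apply: runs_write => /=; last by lia.
    rewrite sn stb (_ : table n = H p 1%N); first by rewrite /m1 k0.
    by rewrite np; apply: tableE; rewrite // -np.
  apply: (@runs_call (C * T)) => /=; last by lia.
  rewrite md mk sn /T (negPf k_neq0).
  by apply: runs_weaken (callE p_pr g (ltn0Sn k)) _ _ => // m' ->.
move=> _ <-; apply: (@runs_seq (100 * k.+2) 10); last by lia.
have [fr1 m1n] : frame [:: trace_arr] m m1 /\ forall i : nat,
    m1 trace_arr i = if i == n then H p k.+1 else m trace_arr i.
  by split=> [|i]; [apply: frame_upd; rewrite inE | rewrite /m1 mem_updE eqxx].
have p_gt1 := prime_gt1 p_pr.
apply: runs_weaken (runs_convolution (p := p) (k := k) _ _ p_pr _ _) _ _ => //.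
move=> m2 [m2acc fr2]; apply: runs_write => //=.
have {}m2acc : m2 acc_reg 0 = l p k.+1 * k.+1%:Z.
  rewrite m2acc mulrC l_rec //; congr (- _); apply: eq_bigr => i _.
  rewrite m1n fr1 // sl //; last by rewrite ltn_exp2l // ltnS leq_subr.
  congr (_ * _); rewrite /n eqn_exp2l // eqSS; case: eqP => [->//|/eqP ik].
  by apply: str => //; rewrite ltn_exp2l // ltnS ltn_neqAle ik -ltnS ltn_ord.
have fr12 : frame [:: local_arr; trace_arr; acc_reg; f_reg] m m2.
  apply: (@frame_trans _ _ m1); first by apply: frame_sub fr1 => i; rewrite !inE => /eqP->.
  by apply: frame_sub fr2 => i; rewrite !inE => /orP[]/eqP->.
have m2k : m2 k_reg 0 = k.+1%:Z by rewrite fr12.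
rewrite m2acc m2k mulzK //.
split; last by apply: frame_trans fr12 _; apply: frame_upd; rewrite inE.
have m2n : m2 n_reg 0 = n%:Z by rewrite fr12.
rewrite m2n; split=> [||i|q q_pr|i i_n|q j q_pr gq j_gt0 qn|q j q_pr qn];
  rewrite mem_updE /=.
- by rewrite fr12.
- by rewrite fr12.
- by rewrite fr12 // stb.
- by rewrite fr12 // sb.
- by rewrite fr12 // sc.
- rewrite fr2 // m1n; case: eqP => [/prime_power_inj[]// -> ->//|/eqP ne].
  by apply: str => //; rewrite ltn_neqAle ne -ltnS.
rewrite eqz_nat fr2 // fr1 //; case: eqP => [/prime_power_inj[]// -> ->//|/eqP ne].
by apply: sl => //; case/orP: qn => [|->]; rewrite ?orbT // ltnS leq_eqVlt (negPf ne) /= => ->.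
Qed.

Lemma state_write_coefficient n m :
  state n n.+1 m ->
  state n.+1 n.+1 (mem_upd (mem_upd m coef_arr n%:Z (a n)) n_reg 0 n.+1%:Z).
Proof.
move=> [sn sa stb sb sc str sl].
split=> [||i|q q_pr|i|q j q_pr gq j_gt0 qn|q j q_pr qn] //; rewrite ?mem_updE /=; auto.
rewrite eqz_nat ltnS => /andP[i_gt0 i_n].
by case: eqP => [->//|/eqP ne]; rewrite sc // i_gt0 ltn_neqAle ne.
Qed.

(** The cost, up to a constant, of the trace evaluation made when n is
    reached: it takes place only when n = p^k with k >= 2. *)
Definition prime_power_cost n : nat :=
  let k := logn (pdiv n) n in
  if (1 < k)%N && (n == pdiv n ^ k)%N then (k * n)%N else 0%N.

Lemma sqr_leq_exp2 k : (k ^ 2 <= 4 * 2 ^ k)%N.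
Proof.
elim: k => // k IH; case: (leqP k 2) => [|k3]; first by case: k {IH} => [|[|[|]]].
rewrite [(2 ^ _)%N]expnS mulnCA; apply: leq_trans (leq_mul (leqnn 2) IH).
by rewrite -!mulnn; nia.
Qed.

(** The exponents met at n are at most logarithmic in n, but trial division costs
    sqrt n anyway, so this weaker bound suffices for the loops over them. *)
Lemma logn_lt_sqrt p n s : prime p -> (0 < n)%N -> (n < s.+1 ^ 2)%N ->
  (logn p n < 2 * s.+1)%N.
Proof.
move=> p_pr n_gt0 ns; rewrite -(ltn_sqr (logn p n)) expnMn.
apply: leq_ltn_trans (sqr_leq_exp2 _) _; rewrite ltn_pmul2l //.
apply: leq_ltn_trans ns; apply: leq_trans (dvdn_leq n_gt0 (pfactor_dvdnn p n)).
by case: (logn p n) => // k; rewrite leq_exp2r // prime_gt1.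
Qed.

Lemma runs_coefficient n s m :
  (1 < n <= X)%N -> (X < s.+1 ^ 2)%N -> state n n m ->
  runs (coefficient_cmd E) m (1000 * s.+1 + C * prime_power_cost n)
    (state n.+1 n.+1).
Proof.
move=> /andP[n_gt1 nX] Xs st; have n_gt0 := ltnW n_gt1.
have ns := leq_ltn_trans nX Xs.
rewrite /prime_power_cost; set p := pdiv n; set k := logn p n; set T := (if _ then _ else _).
have p_pr : prime p := pdiv_prime n_gt1.
have p_n : (p %| n)%N := pdiv_dvd n.
have k_gt0 : (0 < k)%N by rewrite -pfactor_dvdn // expn1.
have ks : (k < 2 * s.+1)%N by exact: logn_lt_sqrt.
have pk_n : (p ^ k %| n)%N by rewrite pfactor_dvdn.
have pk_gt0 : (0 < p ^ k)%N by rewrite expn_gt0 prime_gt0.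
apply: (@runs_seq (50 * s.+1) (900 * s.+1 + C * T)); last by lia.
apply: runs_weaken (runs_smallest_factor n_gt1 ns (state_n st)) _ _ => // m1 [m1d fr1].
have {}st : state n n m1.
  by apply: state_frame st; apply: frame_sub fr1 => i; rewrite !inE => ->.
apply: (@runs_seq (100 * s.+1) (780 * s.+1 + C * T)); last by lia.
apply: runs_weaken (runs_factor_out n_gt0 p_pr (state_n st) m1d) _ _; first by rewrite -/k; lia.
move=> m2 [m2m m2k fr2]; rewrite -/k in m2m m2k.
have m2d : m2 d_reg 0 = p%:Z by rewrite fr2.
have {m1d fr1 fr2} st : state n n m2.
  by apply: state_frame st; apply: frame_sub fr2 => i; rewrite !inE => /orP[]->; rewrite ?orbT.
apply: (@runs_seq (760 * s.+1 + C * T) 10); last by lia.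
suff : runs (If (Bin OpEq (reg m_reg) (Cst 1))
         (Seq (local_factor_cmd E)
         (Seq (convolution_cmd local_arr coef_arr)
              (Write coef_arr (reg n_reg) (reg acc_reg))))
         (Write coef_arr (reg n_reg)
            (Bin OpMul (Read coef_arr (Bin OpQuo (reg n_reg) (reg m_reg)))
                       (Read coef_arr (reg m_reg)))))
    m2 (760 * s.+1 + C * T)
    (fun m => exists2 m', state n n.+1 m' & m = mem_upd m' coef_arr n%:Z (a n)).
  move=> run; apply: runs_weaken run _ _ => // _ [m3 st3 ->]; apply: runs_write => //.
  rewrite /= mem_updE /= (state_n st3) -(PoszD n 1) addn1.
  exact: state_write_coefficient.
apply: (@runs_if (750 * s.+1 + C * T)) => /=; last by lia.
rewrite m2m (_ : ((n %/ p ^ k)%N%:Z == 1) = (n == p ^ k)%N); last first.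
  by rewrite -[1]/(1%:Z) eqz_nat; apply/eqP/eqP => [e|{1}->];
    rewrite ?divnn ?pk_gt0 // -[LHS](divnK pk_n) e mul1n.
have [n_pk|n_pk] := eqVneq n (p ^ k)%N => /=.
- pose K := k.-1; have kK : k = K.+1 by rewrite prednK.
  have st2n := state_n st; rewrite n_pk kK in st2n.
  have DT : T = (if K == 0%N then 0 else K.+1 * n)%N.
    by rewrite /T -n_pk eqxx andbT kK ltnS lt0n; case: (K == 0%N).
  apply: (@runs_seq (200 * K.+2 + C * T) (110 * K.+2)); last by lia.
  rewrite DT; rewrite n_pk kK in st nX *.
  apply: runs_weaken (runs_local_factor p_pr nX st m2d _) _ _ => //; first by rewrite m2k kK.
  move=> m3 [st3 fr3].
  have m3d : m3 d_reg 0 = p%:Z by rewrite fr3.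
  apply: (@runs_seq (100 * K.+2) 10); last by lia.
  apply: runs_weaken (runs_convolution (A := local_arr) (B := coef_arr) _ _ p_pr
    (state_n st3) m3d) _ _ => //.
  move=> m4 [m4acc fr4]; apply: runs_write => //=; exists m4.
    by apply: state_frame st3; apply: frame_sub fr4 => i; rewrite !inE => /orP[]->; rewrite ?orbT.
  rewrite fr4 // (state_n st3) m4acc a_prime_power //; congr (mem_upd _ _ _ (- _)).
  apply: eq_bigr => i _; rewrite (state_local st3) //; last first.
    by rewrite ltnS leq_exp2l ?prime_gt1 // ltn_ord.
  by rewrite (state_coef st3) // expn_gt0 prime_gt0 //= ltn_exp2l ?prime_gt1 // ltnS leq_subr.
(* The new bound on prime powers is void when n is not a prime power. *)
have not_prime_power q j : prime q -> (q ^ j < n.+1)%N = (q ^ j < n)%N.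
  move=> q_pr; rewrite ltnS leq_eqVlt; case: eqP => //= Dn.
  case: j Dn => [|j] Dn; first by rewrite -Dn in n_gt1.
  by case/eqP: n_pk; rewrite /k /p -Dn pdiv_pfactor // pfactorK.
have q_gt0 : (0 < n %/ p ^ k)%N by rewrite divn_gt0 // dvdn_leq.
apply: runs_write => /=; last by lia.
exists m2.
  case: st => [sn sa stb sb sc str sl]; split=> // q j q_pr.
    by rewrite not_prime_power //; exact: str.
  by rewrite not_prime_power //; exact: sl.
rewrite (state_n st) m2m divz_nat !(state_coef st).
- by rewrite (_ : (n %/ (n %/ p ^ k))%N = (p ^ k)%N) -?(a_split p_pr) // -{1}(divnK pk_n) mulKn.
- rewrite q_gt0 ltn_Pdiv // -{1}(expn0 p) ltn_exp2l // prime_gt1 //.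
- rewrite (_ : (n %/ (n %/ p ^ k))%N = (p ^ k)%N); last by rewrite -{1}(divnK pk_n) mulKn.
  by rewrite pk_gt0 ltn_neqAle eq_sym n_pk dvdn_leq.
Qed.

Definition write_table_cmd (A : nat) (g : nat -> int) (s : seq nat) : cmd :=
  foldr (fun x c => Seq (Write A (Cst x%:Z) (Cst (g x))) c) Skip s.

(** Finitely many constants are part of the program text: this is how the local
    factors at the bad primes are supplied. *)
Lemma runs_write_table A g s m :
  runs (write_table_cmd A g s) m (4 * size s).+1
    (fun m' => frame [:: A] m m' /\
       forall i : nat, m' A i%:Z = if i \in s then g i else m A i%:Z).
Proof.
elim: s m => [|x s IH] m /=; first by apply: runs_skip.
apply: (@runs_seq 3 (4 * size s).+1); last by lia.
apply: runs_write => //=.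
apply: runs_weaken (IH _) _ _ => // m' [fr m'E]; split.
  by apply: frame_trans fr; apply: frame_upd; rewrite inE.
move=> i; rewrite m'E inE mem_updE eqxx eqz_nat /=.
by case: eqP => [->|_] //=; rewrite if_same.
Qed.

Variables (bad_primes : seq nat) (deg : nat -> nat).

Hypothesis bad_primesP : forall p, prime p -> (p \in bad_primes) = ~~ good p.
Hypothesis l0 : forall p, prime p -> l p 0%N = 1.
Hypothesis l_deg : forall p k, prime p -> ~~ good p -> (deg p <= k)%N -> l p k = 0.
Hypothesis a1 : a 1%N = 1.

(** Index 1 = p^0 is shared by all primes, whose local factors all have constant
    term 1. *)
Definition preset_indices : seq nat :=
  1%N :: [seq (p ^ k)%N | p <- bad_primes, k <- iota 0 (deg p)].

Definition preset_value (x : nat) : int :=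
  if x == 1%N then 1 else l (pdiv x) (logn (pdiv x) x).

Definition dirichlet_cmd : cmd :=
  Seq (Write coef_arr (Cst 1) (Cst 1))
 (Seq (write_table_cmd bad_arr (fun=> 1) bad_primes)
 (Seq (write_table_cmd local_arr preset_value preset_indices)
 (Seq (assign n_reg (Cst 2))
      (While (Bin OpLe (reg n_reg) (reg arg_arr)) (coefficient_cmd E))))).

Lemma preset_valueE p k : prime p -> preset_value (p ^ k) = l p k.
Proof.
move=> p_pr; rewrite /preset_value; case: k => [|k]; first by rewrite l0.
rewrite pdiv_pfactor // pfactorK // ifN //.
by rewrite neq_ltn -{2}(expn0 p) ltn_exp2l ?prime_gt1 ?orbT.
Qed.

Lemma runs_dirichlet s :
  (0 < X)%N -> (X < s.+1 ^ 2)%N ->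
  runs dirichlet_cmd (mem_init [:: X%:Z] table)
    (4 * (size bad_primes + size preset_indices) + 30 +
     \sum_(2 <= n < X.+1) (1000 * s.+1 + C * prime_power_cost n + 6))
    (fun m => forall n, (0 < n <= X)%N -> mem_out m n = a n).
Proof.
move=> X_gt0 Xs; set S := \sum_(_ <= _ < _) _.
set sb := size bad_primes; set sp := size preset_indices.
apply: (@runs_seq 3 (4 * (sb + sp) + 26 + S)); last by lia.
apply: runs_write => //.
apply: (@runs_seq (4 * sb).+1 (4 * sp + 24 + S)); last by lia.
apply: runs_weaken (runs_write_table _ _ _ _) _ _ => // m1 [fr1 m1E].
apply: (@runs_seq (4 * sp).+1 (22 + S)); last by lia.
apply: runs_weaken (runs_write_table _ _ _ _) _ _ => // m2 [fr2 m2E].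
apply: (@runs_seq 3 (18 + S)); last by lia.
apply: runs_write => //=.
have st2 : state 2 2 (mem_upd m2 n_reg 0 2).
  split=> [||i|p p_pr|i|p j p_pr _ j_gt0|p j p_pr]; rewrite mem_updE //=.
  - by rewrite fr2 // fr1.
  - by rewrite fr2 // fr1.
  - by rewrite fr2 // m1E bad_primesP //; case: (good p).
  - by case: i => [|[|i]] // _; rewrite fr2 // fr1 // a1.
  - by rewrite ltnS leqNgt -{1}(expn0 p) ltn_exp2l ?prime_gt1 // j_gt0.
  rewrite m2E fr1 //= preset_valueE //; case: ifP => // /negbT nin small.
  have j_gt0 : (0 < j)%N by move: nin; rewrite /preset_indices; case: j {small}; rewrite // inE.
  have p_bad : ~~ good p.
    case/orP: small => //.
    by rewrite ltnS leqNgt -{1}(expn0 p) ltn_exp2l ?prime_gt1 // j_gt0.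
  rewrite l_deg // leqNgt; apply: contra nin => jd.
  rewrite inE; apply/orP; right; apply/allpairsPdep; exists p, j.
  by rewrite bad_primesP // mem_iota.
pose I n m := state n n m.
apply: (@runs_weaken _ _ (18 + S) _ (I X.+1)) => //; last first.
  by move=> m [_ _ _ _ sc _ _] n nX; rewrite /mem_out sc.
have ev n m : I n m -> expr_eval m (Bin OpLe (reg n_reg) (reg arg_arr)) = (n <= X)%N%:Z.
  by move=> Im /=; rewrite (state_n Im) (state_arg Im).
apply: (@runs_for I (fun n => 1000 * s.+1 + C * prime_power_cost n)%N _ _ 2%N X.+1) => //.
- move=> n m /andP[n_gt1 nX] Im; split; first by rewrite (ev _ _ Im) -ltnS nX.
  by apply: runs_coefficient; rewrite ?n_gt1.
- by move=> m Im; rewrite (ev _ _ Im) ltnn.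
rewrite (eq_bigr (fun n => 1000 * s.+1 + C * prime_power_cost n + 6)%N) -/S /=; first by lia.
by move=> n _ /=; lia.
Qed.

End Coefficients.

(** * The total cost of evaluating traces at prime powers *)

Lemma sqrtn_exists n : exists s, (s ^ 2 <= n < s.+1 ^ 2)%N.
Proof.
elim: n => [|n [s /andP[sn ns]]]; first by exists 0%N.
case: (leqP (s.+1 ^ 2) n.+1) => [sn1|]; last by exists s; rewrite ltnW.
by exists s.+1; rewrite sn1 (leq_ltn_trans ns) // ltn_sqr.
Qed.

Lemma sum_below_leq N b c :
  (\sum_(0 <= i < N) (if (i < b)%N then c else 0) <= b * c)%N.
Proof.
suff : (\sum_(0 <= i < N) (if (i < b)%N then c else 0) <= minn N b * c)%N.
  by move/leq_trans; apply; rewrite leq_mul2r geq_minr orbT.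
elim: N => [|N IH]; first by rewrite big_geq.
rewrite big_nat_recr //=; case: ltnP => [Nb|bN].
  rewrite (minn_idPl Nb) mulSn addnC leq_add2l.
  by apply: leq_trans IH _; rewrite leq_mul2r geq_minl orbT.
by rewrite addn0 (minn_idPr (leqW bN)); apply: leq_trans IH _; rewrite leq_mul2r geq_minr orbT.
Qed.

Lemma leq_sum_term (r : seq nat) (F : nat -> nat) i :
  i \in r -> (F i <= \sum_(j <- r) F j)%N.
Proof. by move=> ir; rewrite (big_rem i) //= leq_addr. Qed.

(** A prime power determines its base and exponent, so the sum over n is at
    most a sum over pairs (d, k); the pairs with d, k >= 2 and d^k <= X satisfy
    d <= sqrt X and k <= log_2 X. *)
Lemma sum_prime_power_cost_pairs X s K :
  (X < s.+1 ^ 2)%N -> (X < 2 ^ K.+1)%N ->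
  (\sum_(2 <= n < X.+1) prime_power_cost n <=
   \sum_(0 <= d < s.+1) \sum_(0 <= k < K.+1)
      if [&& 1 < d, 1 < k & d ^ k <= X] then k * X else 0)%N.
Proof.
move=> Xs XK.
pose F n d k := if [&& 1 < d, 1 < k & n == d ^ k]%N then (k * X)%N else 0%N.
apply: (@leq_trans (\sum_(2 <= n < X.+1) \sum_(0 <= d < s.+1) \sum_(0 <= k < K.+1) F n d k)).
  rewrite big_nat_cond [X in (_ <= X)%N]big_nat_cond; apply: leq_sum => n.
  rewrite andbT ltnS => /andP[n_gt1 nX]; rewrite /prime_power_cost.
  set p := pdiv n; set k := logn p n; case: ifP => // /andP[k_gt1 /eqP Dn].
  have p_gt1 : (1 < p)%N by rewrite prime_gt1 ?pdiv_prime.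
  have ps : (p < s.+1)%N.
    rewrite -ltn_sqr (leq_ltn_trans _ Xs) // (leq_trans _ nX) // Dn.
    by rewrite leq_exp2l.
  have kK : (k < K.+1)%N.
    rewrite -(@ltn_exp2l 2) // (leq_ltn_trans _ XK) // (leq_trans _ nX) // Dn.
    by rewrite leq_exp2r // ltnW.
  have p_in : p \in index_iota 0 s.+1 by rewrite mem_index_iota.
  have k_in : k \in index_iota 0 K.+1 by rewrite mem_index_iota.
  apply: leq_trans (leq_sum_term (fun d => \sum_(0 <= k < K.+1) F n d k)%N p_in).
  apply: leq_trans (leq_sum_term (F n p) k_in).
  by rewrite /F p_gt1 k_gt1 -Dn eqxx leq_mul2l nX orbT.
rewrite exchange_big /=; apply: leq_sum => d _.
rewrite exchange_big /=; apply: leq_sum => k _.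
rewrite /F; case: (1 < d)%N => /=; last by rewrite big1.
case: (1 < k)%N => /=; last by rewrite big1.
case: (leqP (d ^ k) X) => [dkX|Xdk].
  have [dk_in|dk_notin] := boolP ((d ^ k)%N \in index_iota 2 X.+1).
    rewrite (bigD1_seq (d ^ k)%N) ?iota_uniq //= eqxx big1 ?addn0 //.
    by move=> i /negPf ->.
  by rewrite big1_seq // => i /andP[_ i_in]; case: eqP => // e; rewrite -e i_in in dk_notin.
rewrite big1_seq // => i /andP[_]; rewrite mem_index_iota ltnS => /andP[_ iX].
by case: eqP => // e; rewrite e leqNgt Xdk in iX.
Qed.

(** With w the integer part of the fourth root of X, a base d > w only admits
    the exponents k < 4, at a cost O(X) for each of the sqrt X bases; the
    smaller bases cost O(K^2 X) each, where K, the integer part of log_2 X,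
    satisfies K^2 = O(w).  In total this is O(X sqrt X + X w^2), and
    w^2 <= sqrt X. *)
Lemma sum_prime_power_cost_leq X s :
  (0 < X)%N -> (s ^ 2 <= X < s.+1 ^ 2)%N ->
  (\sum_(2 <= n < X.+1) prime_power_cost n <= 300 * (X * s.+1))%N.
Proof.
move=> X_gt0 /andP[sX Xs].
have [w /andP[ws sw]] := sqrtn_exists s.
have w_gt0 : (0 < w)%N.
  by case: w sw {ws} => //; rewrite ltnS leqn0 => /eqP s0; rewrite s0 ltnNge X_gt0 in Xs.
pose K := trunc_log 2 X; pose u := (K %/ 4)%N.
have KX : (2 ^ K <= X)%N by apply: trunc_logP.
have XK : (X < 2 ^ K.+1)%N by apply: trunc_log_ltn.
have Xw : (X < w.+1 ^ 4)%N.
  by apply: leq_trans Xs _; rewrite (expnM w.+1 2 2) leq_exp2r.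
have uw : (2 ^ u <= w)%N.
  rewrite -ltnS -(@ltn_exp2r _ _ 4) // (leq_ltn_trans _ Xw) // -expnM.
  by rewrite (leq_trans _ KX) // leq_exp2l // leq_trunc_div.
(* K + 1 <= 4 (u + 1) and (u + 1)^2 <= 4 * 2^(u + 1) <= 8 w. *)
have Kw : (K * K.+1 <= 128 * w)%N.
  have Ku : (K.+1 <= 4 * u.+1)%N.
    by have := divn_eq K 4; have := ltn_pmod K (isT : 0 < 4)%N; rewrite -/u; lia.
  apply: leq_trans (leq_mul (ltnW Ku) Ku) _; rewrite mulnACA mulnn.
  by have := sqr_leq_exp2 u.+1; rewrite [(2 ^ _)%N]expnS; lia.
apply: leq_trans (sum_prime_power_cost_pairs Xs XK) _.
apply: (@leq_trans (\sum_(0 <= d < s.+1) (12 * X + if (d < w.+1)%N then K * X * K.+1 else 0))%N).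
  apply: leq_sum => d _; case: (ltnP d w.+1) => dw.
    apply: leq_trans (leq_addl _ _).
    apply: (@leq_trans (\sum_(0 <= k < K.+1) K * X)%N).
      rewrite big_nat_cond [X in (_ <= X)%N]big_nat_cond; apply: leq_sum => k.
      by rewrite andbT ltnS => /andP[_ kK]; case: ifP => // _; rewrite leq_mul2r kK orbT.
    by rewrite sum_nat_const_nat subn0 mulnC.
  (* At most the four exponents k < 4 occur, each costing at most 3 X. *)
  rewrite addn0 (_ : 12 * X = 4 * (3 * X))%N; last by rewrite mulnA.
  apply: leq_trans _ (sum_below_leq K.+1 4 (3 * X)).
  apply: leq_sum => k _; case: ifP => // /and3P[d_gt1 _ dkX].
  have k4 : (k < 4)%N.
    rewrite ltnNge; apply: contraL Xw => k_ge4; rewrite -leqNgt (leq_trans _ dkX) //.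
    by rewrite (@leq_trans (d ^ 4)) ?leq_exp2r // leq_exp2l.
  by rewrite k4 leq_mul2r -ltnS k4 orbT.
rewrite big_split /= sum_nat_const_nat subn0.
have := sum_below_leq s.+1 w.+1 (K * X * K.+1).
set T := \sum_(_ <= _ < _) _.
move=> TT.
have T1 : (T <= 256 * (X * s.+1))%N.
  apply: leq_trans TT _; rewrite mulnAC mulnA [X in (_ <= X)%N]mulnCA [X in (_ <= X)%N]mulnC.
  rewrite leq_mul2r; apply/orP; right.
  apply: (@leq_trans ((2 * w) * (128 * w))%N); first by apply: leq_mul; lia.
  by rewrite mulnACA leq_mul2l mulnn ltnW.
by lia.
Qed.

(** * The theorem *)

(** A bad prime divides one of the finitely many nonzero numerators and
    denominators of z, z - 1 and the parameters, hence their product N. *)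
Lemma bad_primes_finite (alpha beta : seq rat) (z : rat) :
  z != 0 -> z != 1 ->
  exists bs : seq nat, forall p, prime p -> (p \in bs) = ~~ good_prime alpha beta z p.
Proof.
move=> z0 z1.
pose xs := [:: z; z - 1] ++ alpha ++ beta.
pose N := (\prod_(x <- xs)
   (`|denq x| * (if x == 0%R then 1 else `|numq x|)))%N.
have N_gt0 : (0 < N)%N.
  apply: prodn_gt0 => x; rewrite muln_gt0 absz_gt0 denq_eq0 /=.
  by case: eqP => // /eqP x0; rewrite absz_gt0 numq_eq0.
have dvdN x : x \in xs ->
    (`|denq x| %| N)%N /\ (x != 0 -> (`|numq x| %| N)%N).
  move=> x_in; rewrite /N (big_rem x) //=; split; first by rewrite dvdn_mulr // dvdn_mulr.
  by move=> /negPf ->; rewrite dvdn_mulr // dvdn_mull.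
have integral p x : prime p -> (N < p)%N -> x \in xs ->
    padic_integral p x /\ (x != 0 -> padic_unitq p x).
  move=> p_pr Np /dvdN[dN nN].
  have small d : (d %| N)%N -> ~~ (p %| d)%N.
    move=> d_N; apply: contraL Np => p_d; rewrite -leqNgt dvdn_leq //.
    exact: dvdn_trans p_d d_N.
  split=> [|/nN nN']; first exact: small.
  by rewrite /padic_unitq /padic_integral !small.
exists [seq p <- iota 0 N.+1 | ~~ good_prime alpha beta z p] => p p_pr.
rewrite mem_filter mem_iota /= add0n ltnS; case: leqP => [_|Np]; first by rewrite andbT.
rewrite andbF; apply/esym/negbTE; rewrite negbK /good_prime p_pr.
rewrite !(proj2 (integral p _ p_pr Np _)) ?subr_eq0 ?inE ?eqxx ?orbT //=.
apply/andP; split; apply/allP => x x_in; apply: (proj1 (integral p x p_pr Np _)).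
  by rewrite !inE mem_cat x_in !orbT.
by rewrite !inE mem_cat x_in !orbT.
Qed.

(** The arithmetic behind the program: over the integers, the local factors and
    the Dirichlet coefficients are determined by recurrences along prime powers
    and by multiplicativity. *)
Lemma hyper_lcoef_recurrences (r : nat) (alpha beta : seq rat) (z : rat)
    (H : nat -> nat -> int) (badL : nat -> {poly int})
    (good := good_prime alpha beta z) (c := hyper_lcoef alpha beta z H badL) :
  (forall p, good p -> trace_formula r (H p)) ->
  (forall p, prime p -> ~~ good p -> (badL p)`_0 = 1) ->
  exists (l : nat -> nat -> int) (a : nat -> int),
    [/\ forall p, prime p -> l p 0%N = 1,
        forall p k, prime p -> ~~ good p -> l p k = (badL p)`_k
      & forall p k, prime p -> good p ->
          k.+1%:Z * l p k.+1 = - \sum_(i < k.+1) H p i.+1 * l p (k - i)%N] /\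
    [/\ forall n, (0 < n)%N -> (a n)%:~R = c n,
        a 1%N = 1,
        forall p k, prime p ->
          a (p ^ k.+1)%N = - \sum_(i < k.+1) l p i.+1 * a (p ^ (k - i))%N
      & forall p n, prime p -> (0 < n)%N -> (p %| n)%N ->
          a n = a (p ^ logn p n)%N * a (n %/ p ^ logn p n)%N].
Proof.
move=> trace badL0.
have /choice[Lg LgP] p : exists L : {poly int}, good p ->
    [/\ L`_0 = 1,
        forall n, n.+1%:R * L`_n.+1 = - \sum_(i < n.+1) H p i.+1 * L`_(n - i)
      & forall n, fps_exp (fun f => if f == 0%N then 0 else - ((H p f)%:~R / f%:R)) n =
                  (L`_n)%:~R].
  case: (boolP (good p)) => [g|_]; last by exists 0.
  by have [L LP] := fps_exp_trace (trace p g); exists L.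
pose l p k : int := if good p then (Lg p)`_k else (badL p)`_k.
have lE p k : hyper_euler_factor alpha beta z H badL p k = (l p k)%:~R.
  rewrite /hyper_euler_factor /l -/(good p); case: ifP => // g.
  by have [_ _ ->] := LgP p g.
have l0 p : prime p -> l p 0%N = 1.
  by move=> p_pr; rewrite /l; case: ifP => [/LgP[]//|/negbT g]; exact: badL0.
pose u p := fps_inv (hyper_euler_factor alpha beta z H badL p).
have u0 p : prime p -> u p 0%N = 1 by rewrite /u fps_inv0.
have uS p n : prime p ->
    u p n.+1 = - \sum_(i < n.+1) (l p i.+1)%:~R * u p (n - i)%N.
  move=> p_pr; rewrite /u fps_invS ?lE ?l0 //; congr (- _); apply: eq_bigr => i _.
  by rewrite lE.
have uZ p n : prime p -> u p n \is a Num.int.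
  move=> p_pr; elim/ltn_ind: n => -[|n] IH; first by rewrite u0 // rpred1.
  rewrite uS // rpredN rpred_sum // => i _; rewrite rpredM ?intr_int // IH //.
  by rewrite ltnS leq_subr.
have cE n : c n = euler_product u n by [].
have cZ n : (0 < n)%N -> c n \is a Num.int.
  move=> n_gt0; rewrite cE (euler_productE (N := n)) ?n_gt0 ?leqnn //.
  by rewrite big_seq rpred_prod // => p; rewrite mem_filter => /andP[p_pr _]; exact: uZ.
pose a n : int := numq (c n).
have aE n : (0 < n)%N -> (a n)%:~R = c n by move=> /cZ; exact: numqK.
have pk_gt0 p k : prime p -> (0 < p ^ k)%N by move=> p_pr; rewrite expn_gt0 prime_gt0.
have c_pk p k : prime p -> c (p ^ k)%N = u p k.
  move=> p_pr; rewrite cE; case: k => [|k]; first by rewrite euler_product1 ?u0.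
  by rewrite euler_product_prime_power.
exists l, a; split; split=> //.
- by move=> p k p_pr /negPf g; rewrite /l g.
- by move=> p k p_pr g; rewrite /l g; have [_ LS _] := LgP p g; rewrite -natz.
- by apply: (@intr_inj rat); rewrite aE // cE euler_product1.
- move=> p k p_pr; apply: (@intr_inj rat); rewrite aE ?pk_gt0 // c_pk // uS //.
  rewrite rmorphN rmorph_sum; congr (- _); apply: eq_bigr => i _.
  by rewrite rmorphM /= aE ?pk_gt0 // c_pk.
- move=> p n p_pr n_gt0 p_n; apply: (@intr_inj rat).
  rewrite rmorphM /= !aE ?pk_gt0 //; first by rewrite !cE -euler_product_split.
  by rewrite divn_gt0 ?pk_gt0 // dvdn_leq // pfactor_dvdnn.
Qed.

Lemma powR_three_halves (R : realType) (X s : nat) :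
  (s ^ 2 <= X)%N -> (X * s)%:R <= X%:R `^ (3 / 2) :> R.
Proof.
move=> sX; have -> : (3 / 2 : R) = 1 + 2^-1 by field.
case: (posnP X) => [->|X_gt0]; first by rewrite mul0n powR_ge0.
rewrite powRD ?pnatr_eq0 ?gtn_eqF ?implybT // powRr1 // powR12_sqrt // natrM ler_wpM2l //.
by rewrite -[s%:R]ger0_norm // -sqrtr_sqr ler_wsqrtr // -natrX ler_nat.
Qed.

Theorem theorem2p29 (R : realType) (r : nat) (alpha beta : r.-tuple rat)
    (z : rat) (H : nat -> nat -> int) (badL : nat -> {poly int})
    (datum : hypergeometric_datum alpha beta) (alpha_neq0 : 0 \notin alpha)
    (z_neq0 : z != 0) (z_neq1 : z != 1)
    (HE : forall p f, good_prime alpha beta z p -> (0 < f)%N ->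
       (H p f)%:~R = hyper_sum alpha beta z p f)
    (trace : forall p, good_prime alpha beta z p -> trace_formula r (H p))
    (badL0 : forall p, prime p -> ~~ good_prime alpha beta z p ->
       (badL p)`_0 = 1)
    (evalH : evaluation_cost (good_prime alpha beta z) H) :
  exists (P : cmd) (C : R), forall X : nat, (0 < X)%N ->
  exists (t : nat) (m : memory),
    [/\ exec P
          (mem_init [:: X%:Z]
             (fun p => if good_prime alpha beta z p && (p <= X)%N
                       then H p 1%N else 0)) t m,
        t%:R <= C * X%:R `^ (3 / 2)
      & forall n, (0 < n <= X)%N ->
          (mem_out m n)%:~R = hyper_lcoef alpha beta z H badL n].
Proof.
have [bs bsP] := bad_primes_finite alpha beta z_neq0 z_neq1.
have [l [a [[l0 l_bad l_rec] [aE a1 a_pk a_split]]]] := hyper_lcoef_recurrences trace badL0.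
have [E [C evalE]] := evalH.
pose deg p := size (badL p).
pose B := (4 * (size bs + size (preset_indices bs deg)) + 30 + 2 * (1006 + 300 * C))%N.
pose table X p := if good_prime alpha beta z p && (p <= X)%N then H p 1%N else 0.
exists (dirichlet_cmd l E bs deg).
exists B%:R.
move=> X X_gt0; have [s /andP[sX Xs]] := sqrtn_exists X.
have s_gt0 : (0 < s)%N by case: s Xs {sX} => //; rewrite ltnNge X_gt0.
have [|||t [m [ex tX out]]] := @runs_dirichlet (good_prime alpha beta z) H l a X (table X) E C
   _ _ l_rec a_pk a_split bs deg bsP l0 _ a1 s X_gt0 Xs.
- by move=> p _ g pX; rewrite /table g pX.
- by move=> p f _ g f_gt0; have [t [m [ex Hm tC]]] := evalE p f g f_gt0; exists t, m.
- by move=> p k p_pr g dk; rewrite l_bad // nth_default.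
exists t, m; split=> //; last first.
  by move=> n nX; rewrite out // aE //; case/andP: nX.
have tXs : (t <= B * (X * s))%N.
  apply: leq_trans tX _; rewrite mulnDl leq_add //.
    by rewrite leq_pmulr // muln_gt0 X_gt0.
  rewrite (eq_bigr (fun n => 1000 * s.+1 + 6 + C * prime_power_cost n)%N); last first.
    by move=> n _; rewrite addnAC.
  rewrite big_split /= -big_distrr /= sum_nat_const_nat.
  have cost := sum_prime_power_cost_leq X_gt0 (introT andP (conj sX Xs)).
  apply: (@leq_trans ((1006 + 300 * C) * (X * s.+1))%N).
    rewrite [X in (_ <= X)%N]mulnDl leq_add //.
      rewrite mulnCA leq_mul //; last by lia.
      by rewrite leq_subLR; lia.
    by rewrite [(300 * C)%N]mulnC -mulnA leq_mul2l cost orbT.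
  apply: (@leq_trans ((1006 + 300 * C) * (2 * (X * s)))%N); last by rewrite mulnCA mulnA.
  by rewrite leq_mul // mulnCA leq_mul //; lia.
apply: (@le_trans _ _ (B * (X * s))%N%:R).
  by rewrite ler_nat.
by rewrite natrM ler_wpM2l // powR_three_halves.
Qed.
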